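(* Let $A$, $B$ be finite-dimensional quantum systems with dimensions $|A|,|B|$, let $\mathcal{Y}$ be a finite outcome set with $|Y|:=|\mathcal{Y}|$, and let $k\ge 2$ be an integer. Let $\{P^y_{AB}\}_{y\in\mathcal{Y}}$ be an arbitrary $k$-extendible POVM. Then there exists a POVM $\{\Lambda^y_{AB}\}_{y\in\mathcal{Y}}\in \operatorname{1WL}$ such that for every $y\in\mathcal{Y}$, $$\left\Vert P^y_{AB}-\Lambda^y_{AB}\right\Vert_1\le |B|^3|Y|^2\left(|B||Y|+1\right)\sqrt{\frac{2\ln 2\,|A|^3}{k}}.$$ In particular, for fixed $|A|,|B|,|Y|$, the set of $k$-extendible POVMs converges to $\operatorname{1WL}$ as $k\to\infty$.
   Context: A POVM $\{P^y_{AB}\}_{y\in\mathcal{Y}}$ is in $\operatorname{1WL}$ (realizable by local operations and one-way classical communication) if $P^y_{AB}=\sum_{x\in\mathcal{X}}E^x_A\otimes F^{x,y}_B$ for some finite set $\mathcal{X}$, a POVM $\{E^x_A\}_{x\in\mathcal{X}}$, and POVMs $\{F^{x,y}_B\}_{y\in\mathcal{Y}}$ for each $x\in\mathcal{X}$. For an integer $k\ge2$, a bipartite POVM $\{P^y_{AB}\}_{y\in\mathcal{Y}}$ is $k$-extendible if there is a POVM $\{G^{y_1^k}_{AB_1^k}\}_{y_1^k\in\mathcal{Y}^k}$ on $A B_1\cdots B_k$ (each $B_i\cong B$; $y_i^j:=(y_i,\dots,y_j)$, $B_i^j:=B_i\cdots B_j$) such that: (i) $\sum_{y_2^k}G^{y_1^k}_{AB_1^k}=P^{y_1}_{AB_1}\otimes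 I_{B_2^k}$ for all $y_1$; (ii) $\sum_{y_k}\operatorname{Tr}_A[G^{y_1^k}_{AB_1^k}]=\frac{1}{|B|}\sum_{y_k}\operatorname{Tr}_{AB_k}[G^{y_1^k}_{AB_1^k}]\otimes I_{B_k}$ for all $y_1^{k-1}\in\mathcal{Y}^{k-1}$; (iii) $W^\pi_{B_1^k}G^{(y_{\pi(1)},\dots,y_{\pi(k)})}_{AB_1^k}(W^\pi_{B_1^k})^\dagger=G^{y_1^k}_{AB_1^k}$ for all $y_1^k$ and all $\pi\in S_k$, where $W^\pi_{B_1^k}$ is the unitary permuting the systems $B_1,\dots,B_k$ according to $\pi$. $\|\cdot\|_1$ is the trace norm. *)

(* Defs.v *)
From HB Require Import structures.
From mathcomp Require Import all_boot all_order all_algebra all_fingroup.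
From mathcomp Require Import complex.
From mathcomp Require Import reals exp.

Set Implicit Arguments.
Unset Strict Implicit.
Unset Printing Implicit Defensive.

Import Order.TTheory GRing.Theory Num.Theory.
Local Open Scope ring_scope.

(* Operators on a finite-dimensional Hilbert space C^I, given by their matrix
   entries in the computational basis indexed by the finite type I. *)
Definition op (C : numClosedFieldType) (I : finType) := I -> I -> C.

Section Ops.
Variable C : numClosedFieldType.

Definition op1 (I : finType) : op C I := fun i j => (i == j)%:R.

Definition op_eq (I : finType) (X Y : op C I) := forall i j, X i j = Y i j.

Definition op_mul (I : finType) (X Y : op C I) : op C I :=
  fun i j => \sum_l X i l * Y l j.

Definition op_adj (I : finType) (X : op C I) : op C I :=
  fun i j => (X j i)^*.

Definition op_tens (I J : finType) (X : op C I) (Y : op C J) : op C (I * J)%type :=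
  fun ij ij' => X ij.1 ij'.1 * Y ij.2 ij'.2.

Definition psd (I : finType) (X : op C I) :=
  forall v : I -> C, 0 <= \sum_i \sum_j (v i)^* * X i j * v j.

Definition is_povm (Y I : finType) (P : Y -> op C I) :=
  (forall y, psd (P y)) /\ op_eq (fun i j => \sum_y P y i j) (@op1 I).

Definition mx_of_op (I : finType) (X : op C I) : 'M[C]_#|I| :=
  \matrix_(a, b) X (enum_val a) (enum_val b).

(* trace norm ||X||_1 = Tr sqrt(X^dagger X) = sum of the square roots of the
   eigenvalues of X^dagger X (spectral decomposition from spectral.v). *)
Definition trnorm (I : finType) (X : op C I) : C :=
  let M := mx_of_op X in
  \sum_i sqrtC (spectral_diag (map_mx Num.conj (M^T) *m M) 0 i).

Definition in_1WL (dA dB : nat) (Y : finType)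
    (P : Y -> op C ('I_dA * 'I_dB)%type) :=
  exists (X : finType) (E : X -> op C 'I_dA) (F : X -> Y -> op C 'I_dB),
    is_povm E /\ (forall x, is_povm (F x)) /\
    forall y, op_eq (P y) (fun i j => \sum_x op_tens (E x) (F x y) i j).

(* System A B_1 ... B_k: basis index (a, b) with b : 'I_k -> 'I_dB. *)
Definition ext_idx (dA dB k : nat) := ('I_dA * {ffun 'I_k -> 'I_dB})%type.

(* W^pi permuting B_1..B_k according to pi: W^pi |a, c> = |a, c o pi^-1>,
   i.e. the content of system i is moved to system pi(i). *)
Definition Wperm (dA dB k : nat) (pi : {perm 'I_k}) : op C (ext_idx dA dB k) :=
  fun ab ab' => ((ab.1 == ab'.1) &&
                 (ab.2 == [ffun i => ab'.2 ((pi^-1)%g i)]))%:R.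

Definition fupd (T : finType) (k : nat) (b : {ffun 'I_k -> T}) (i : 'I_k) (c : T)
  : {ffun 'I_k -> T} := [ffun j => if j == i then c else b j].

(* k-extendibility of a bipartite POVM, conditions (i)-(iii). Positions
   B_1 and B_k are the ordinals 0 and k-1. *)
Definition k_extendible (dA dB : nat) (Y : finType) (k : nat)
    (P : Y -> op C ('I_dA * 'I_dB)%type) :=
  exists G : {ffun 'I_k -> Y} -> op C (ext_idx dA dB k),
    is_povm G /\
    (* (i) sum_{y_2^k} G^{y_1^k} = P^{y_1}_{AB_1} (x) I_{B_2^k} *)
    (forall (i1 : 'I_k), nat_of_ord i1 = 0%N ->
     forall (y1 : Y) (ab ab' : ext_idx dA dB k),
       \sum_(ys : {ffun 'I_k -> Y} | ys i1 == y1) G ys ab ab'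
       = P y1 (ab.1, ab.2 i1) (ab'.1, ab'.2 i1)
         * [forall j, (j != i1) ==> (ab.2 j == ab'.2 j)]%:R) /\
    (* (ii) sum_{y_k} Tr_A G = 1/|B| sum_{y_k} Tr_{AB_k} G (x) I_{B_k},
       for every y_1^{k-1} (given as yf, whose k-th entry is ignored) *)
    (forall (ik : 'I_k), nat_of_ord ik = k.-1 ->
     forall (yf : {ffun 'I_k -> Y}) (b b' : {ffun 'I_k -> 'I_dB}),
       \sum_(ys : {ffun 'I_k -> Y} | [forall j, (j != ik) ==> (ys j == yf j)])
          \sum_(a : 'I_dA) G ys (a, b) (a, b')
       = (dB%:R)^-1 * (b ik == b' ik)%:R *
         \sum_(ys : {ffun 'I_k -> Y} | [forall j, (j != ik) ==> (ys j == yf j)])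
           \sum_(a : 'I_dA) \sum_(c : 'I_dB)
             G ys (a, fupd b ik c) (a, fupd b' ik c)) /\
    (forall (pi : {perm 'I_k}) (ys : {ffun 'I_k -> Y}),
       op_eq (op_mul (op_mul (Wperm (dA:=dA) (dB:=dB) pi) (G [ffun i => ys (pi i)]))
                     (op_adj (Wperm (dA:=dA) (dB:=dB) pi)))
             (G ys)).

End Ops.

(* Main.v *)
(* Measure all the systems B_i of the extension, together with their labels y_i, by an
   informationally complete rank-one measurement. The conditional state of A given the
   first j outcomes is a martingale whose squared Hilbert-Schmidt increments sum to at
   most 1 in expectation, so some increment m is at most 1/k. Informational completeness
   turns the smallness of this increment into the statement that, given the first m
   outcomes, A and the pair (B_m, y_m) are nearly in a product state. Recording
   the first m outcomes on the A side and then applying to B the conditional POVM of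
   (B_m, y_m) is thus close to P; condition (ii) makes the conditional operators on B a
   POVM. Permutation invariance is only used to move conditions (i) and (ii) to
   position m. *)
Require Import Defs.
From HB Require Import structures.
From mathcomp Require Import all_boot all_order all_algebra all_fingroup.
From mathcomp Require Import complex.
From mathcomp Require Import reals exp.
From mathcomp Require Import ring lra.
Import Order.TTheory GRing.Theory Num.Theory.
Local Open Scope ring_scope.

Set Implicit Arguments.
Unset Strict Implicit.
Unset Printing Implicit Defensive.

(** * Positive semidefinite operators and the trace norm *)

Section Scalars.
Variable C : numClosedFieldType.

(** By Lagrange's identity, the right side minus the left is half the double sum of
    [p i * p j * |x i - x j| ^+ 2]. This is Jensen's inequality when the weights sum to 1. *)
Lemma sqr_norm_sum_le (I : finType) (p x : I -> C) :
  (forall i, 0 <= p i) ->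
  `|\sum_i p i * x i| ^+ 2 <= (\sum_i p i) * \sum_i p i * `|x i| ^+ 2.
Proof.
move=> p0.
have pR i : (p i)^* = p i by apply/CrealP/ger0_real.
suff /eqP E : \sum_i \sum_j p i * p j * `|x i - x j| ^+ 2 ==
    2 * ((\sum_i p i) * (\sum_i p i * `|x i| ^+ 2) - `|\sum_i p i * x i| ^+ 2).
  rewrite -subr_ge0 -(pmulr_rge0 _ (ltr0n C 2)) -E.
  by do 2![apply: sumr_ge0 => ? _]; rewrite !mulr_ge0 ?exprn_ge0.
apply/eqP; rewrite normCK rmorph_sum.
transitivity (\sum_i \sum_j (p i * (p j * `|x j| ^+ 2))
  + \sum_i \sum_j ((p i * `|x i| ^+ 2) * p j)
  - \sum_i \sum_j ((p i * x i) * (p j * x j)^*)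
  - \sum_i \sum_j ((p i * x i)^* * (p j * x j))).
  rewrite -!sumrN -!big_split; apply: eq_bigr => i _ /=.
  rewrite -!sumrN -!big_split; apply: eq_bigr => j _ /=.
  by rewrite !normCK !rmorphB !rmorphM /= !pR; ring.
rewrite -!big_distrlr /=; ring.
Qed.

Lemma sum_pair (I J : finType) (F : I * J -> C) :
  \sum_ij F ij = \sum_i \sum_j F (i, j).
Proof. by rewrite pair_bigA; apply: eq_bigr => -[]. Qed.

Lemma psd_diag_ge0 (I : finType) (X : op C I) i : psd X -> 0 <= X i i.
Proof.
move=> /(_ (fun l => (l == i)%:R)).
rewrite (bigD1 i) //= (bigD1 i) //= !eqxx !big1 ?addr0 => [|l /negPf->|l /negPf->].
- by rewrite rmorph1 mul1r mulr1.
- by rewrite big1 // => j _; rewrite rmorph0 !mul0r.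
- by rewrite mulr0.
Qed.

Lemma psd_pair (I : finType) (X : op C I) i j (s t : C) : psd X -> i != j ->
  0 <= s^* * s * X i i + s^* * t * X i j + t^* * s * X j i + t^* * t * X j j.
Proof.
move=> /(_ (fun l => if l == i then s else if l == j then t else 0)) H ij.
apply: le_trans H _; rewrite le_eqVlt; apply/orP; left; apply/eqP.
have ji : j != i by rewrite eq_sym.
have step (F : I -> C) : (forall l, l != i -> l != j -> F l = 0) ->
    \sum_l F l = F i + F j.
  move=> F0; rewrite (bigD1 i) //= (bigD1 j) //= big1 ?addr0 //.
  by move=> l /andP[]; apply: F0.
rewrite step ?step => [|l /negPf-> /negPf->|l /negPf-> /negPf->|l /negPf-> /negPf->].
- by rewrite !eqxx (negPf ji); ring.
- by rewrite mulr0.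
- by rewrite mulr0.
- by rewrite big1 // => ? _; rewrite rmorph0 !mul0r.
Qed.

(** The form is real at the vectors e_i + e_j and e_i + 'i e_j; the two resulting equations
    determine [X j i]. *)
Lemma psd_herm (I : finType) (X : op C I) i j : psd X -> X j i = (X i j)^*.
Proof.
move=> X0; have [->|ij] := eqVneq i j.
  by apply/esym/CrealP/ger0_real/psd_diag_ge0.
have di := CrealP (ger0_real (psd_diag_ge0 i X0)).
have dj := CrealP (ger0_real (psd_diag_ge0 j X0)).
have := CrealP (ger0_real (psd_pair 1 1 X0 ij)).
have := CrealP (ger0_real (psd_pair 1 'i X0 ij)).
rewrite !rmorphD !rmorphM !rmorph1 /= !conjCK !conjCi di dj => E2 E1.
apply: (can_inj (@conjCK C)); rewrite conjCK.
apply: (mulfI (_ : 2 * 'i != 0 :> C)); first by rewrite mulf_neq0 ?neq0Ci ?pnatr_eq0.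
have {}E1 : (X i j)^* + (X j i)^* = X i j + X j i.
  apply: (addIr (X i i + X j j)).
  transitivity (1 * 1 * X i i + 1 * 1 * (X i j)^* + 1 * 1 * (X j i)^* + 1 * 1 * X j j).
    by ring.
  by rewrite E1; ring.
have {}E2 : - 'i * (X i j)^* + 'i * (X j i)^* = 'i * X i j - 'i * X j i.
  apply: (addIr (X i i - 'i * 'i * X j j)).
  transitivity (1 * 1 * X i i + 1 * - 'i * (X i j)^* + 'i * 1 * (X j i)^*
    + 'i * - 'i * X j j); first by ring.
  by rewrite E2; ring.
transitivity ('i * ((X i j)^* + (X j i)^*) + (- 'i * (X i j)^* + 'i * (X j i)^*)); first by ring.
by rewrite E1 E2; ring.
Qed.

Lemma psd_minor_ge0 (I : finType) (X : op C I) i j :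
  psd X -> `|X i j| ^+ 2 <= X i i * X j j.
Proof.
move=> X0; have di := psd_diag_ge0 i X0; have dj := psd_diag_ge0 j X0.
have [->|ij] := eqVneq i j; first by rewrite ger0_norm ?psd_diag_ge0.
have H := psd_herm i j X0.
have [jj0|jj0] := eqVneq (X j j) 0; last first.
  (* At this vector the form equals [X j j] times the 2x2 minor. *)
  have := psd_pair (X j j) (- X j i) X0 ij.
  rewrite rmorphN /= (CrealP (ger0_real dj)) H conjCK normCK => h.
  rewrite -subr_ge0 -(@pmulr_rge0 _ (X j j)) ?lt_def ?jj0 //.
  by apply: le_trans h _; rewrite le_eqVlt; apply/orP; left; apply/eqP; ring.
rewrite jj0 mulr0; have [->|n0] := eqVneq (X i j) 0; first by rewrite normr0 expr0n.
have n1 : 0 < `|X i j| ^+ 2 by rewrite exprn_gt0 ?normr_gt0.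
(* With [X j j = 0] the form is affine in the second coordinate, chosen here so that the value is
   -(X i i + 2) < 0. *)
have := psd_pair 1 (- (X i i + 1) * (X i j)^* / `|X i j| ^+ 2) X0 ij.
rewrite jj0 H rmorph1 mulr0 addr0 !rmorphM fmorphV rmorphXn rmorphN rmorphD rmorph1 /= !conjCK.
rewrite (CrealP (normr_real _)) (CrealP (ger0_real di)).
have -> : 1 * 1 * X i i + 1 * (- (X i i + 1) * (X i j)^* / `|X i j| ^+ 2) * X i j +
    - (X i i + 1) * X i j / `|X i j| ^+ 2 * 1 * (X i j)^* = - (X i i + 2).
  transitivity (X i i - 2 * (X i i + 1) * ((X i j * (X i j)^*) / `|X i j| ^+ 2)).
    by field; rewrite normr_eq0.
  by rewrite -normCK divff ?gt_eqF //; ring.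
have p2 : 0 < X i i + 2 by rewrite ltr_wpDl ?ltr0n.
by rewrite oppr_ge0 => /(lt_le_trans p2); rewrite ltxx.
Qed.

Definition tr (I : finType) (X : op C I) : C := \sum_i X i i.

Definition hs2 (I : finType) (X : op C I) : C := \sum_i \sum_j `|X i j| ^+ 2.

Lemma tr_ge0 (I : finType) (X : op C I) : psd X -> 0 <= tr X.
Proof. by move=> X0; apply: sumr_ge0 => i _; apply: psd_diag_ge0. Qed.

Lemma hs2_ge0 (I : finType) (X : op C I) : 0 <= hs2 X.
Proof. by do 2![apply: sumr_ge0 => ? _]; rewrite exprn_ge0. Qed.

Lemma hs2_le_sqr_tr (I : finType) (X : op C I) : psd X -> hs2 X <= tr X ^+ 2.
Proof.
move=> X0; rewrite expr2 /tr big_distrlr /=.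
by do 2![apply: ler_sum => ? _]; apply: psd_minor_ge0.
Qed.

(** This disposes of outcome prefixes of probability 0, where the operators themselves vanish. *)
Lemma psd_tr_eq0 (I : finType) (X : op C I) i j : psd X -> tr X = 0 -> X i j = 0.
Proof.
move=> X0 t0; have := hs2_le_sqr_tr X0; rewrite t0 expr0n /= => h.
have {h} /eqP : hs2 X == 0 by rewrite eq_le h hs2_ge0.
move/psumr_eq0P => /(_ (fun i _ => sumr_ge0 _ (fun j _ => exprn_ge0 2 (normr_ge0 (X i j))))).
move=> /(_ i isT) /psumr_eq0P => /(_ (fun j _ => exprn_ge0 2 (normr_ge0 (X i j)))) /(_ j isT).
by move/eqP; rewrite sqrf_eq0 normr_eq0 => /eqP.
Qed.

Lemma psd_sum (I J : finType) (Q : pred J) (X : J -> op C I) :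
  (forall j, psd (X j)) -> psd (fun a a' => \sum_(j | Q j) X j a a').
Proof.
move=> X0 v.
have -> : \sum_i \sum_j (v i)^* * (\sum_(l | Q l) X l i j) * v j =
    \sum_(l | Q l) \sum_i \sum_j (v i)^* * X l i j * v j.
  rewrite [RHS]exchange_big; apply: eq_bigr => i _ /=.
  by rewrite [RHS]exchange_big; apply: eq_bigr => j _ /=; rewrite mulr_sumr mulr_suml.
by apply: sumr_ge0 => l _; apply: X0.
Qed.

Lemma psd_scale (I : finType) (c : C) (X : op C I) :
  0 <= c -> psd X -> psd (fun a a' => c * X a a').
Proof.
move=> c0 X0 v.
have -> : \sum_i \sum_j (v i)^* * (c * X i j) * v j =
    c * \sum_i \sum_j (v i)^* * X i j * v j.
  rewrite mulr_sumr; apply: eq_bigr => i _; rewrite mulr_sumr; apply: eq_bigr => j _.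
  by ring.
by rewrite mulr_ge0.
Qed.

Lemma psd_op1 (I : finType) : psd (@op1 C I).
Proof.
move=> v; apply: sumr_ge0 => i _; rewrite (bigD1 i) //= big1 ?addr0.
  by rewrite /op1 eqxx mulr1 mulrC mul_conjC_ge0.
by move=> j ji; rewrite /op1 eq_sym (negPf ji) mulr0 mul0r.
Qed.

Lemma psd_trA (I J : finType) (X : op C (I * J)%type) :
  psd X -> psd (fun b b' => \sum_a X (a, b) (a, b')).
Proof.
move=> X0; apply: psd_sum => a v.
have := X0 (fun ab => if ab.1 == a then v ab.2 else 0).
have pairE (F : I * J -> C) : (forall i, i.1 != a -> F i = 0) ->
    \sum_i F i = \sum_b F (a, b).
  move=> F0; rewrite sum_pair (bigD1 a) //=.
  by rewrite [X in _ + X]big1 ?addr0 // => i ia; apply: big1 => j _; apply: F0.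
rewrite pairE => [|i /negPf E]; last by apply: big1 => j _; rewrite E rmorph0 !mul0r.
congr (0 <= _); apply: eq_bigr => b _; rewrite /= eqxx.
by rewrite pairE /= => [|i /negPf ->]; [rewrite eqxx | rewrite mulr0].
Qed.

Lemma sum_enum_val (I : finType) (F : I -> C) :
  \sum_x F x = \sum_(i < #|I|) F (enum_val i).
Proof. by rewrite (reindex (@enum_val I I)) //; apply/onW_bij/enum_val_bij. Qed.

Lemma spectral_diagE n (A : 'M[C]_n) : A \is normalmx ->
  diag_mx (spectral_diag A) =
  spectralmx A *m A *m map_mx Num.conj (spectralmx A)^T.
Proof.
move=> /orthomx_spectralP AE; have := spectral_unitarymx A.
set U := spectralmx A in AE *; set D := spectral_diag A in AE * => UU.
rewrite {1}AE invmx_unitary // !mulmxA (unitarymxP UU) mul1mx -mulmxA.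
by rewrite (unitarymxP UU) mulmx1.
Qed.

(** Cauchy-Schwarz over the #|I| eigenvalues of X^dagger X: they are nonnegative and their sum
    Tr(X^dagger X) is [hs2 X]. *)
Lemma trnorm_le (I : finType) (X : op C I) :
  trnorm X <= sqrtC (#|I|%:R * hs2 X).
Proof.
rewrite /trnorm; set M := mx_of_op X; set A := _ *m _.
have cc m n (N : 'M[C]_(m, n)) : map_mx Num.conj (map_mx Num.conj N) = N.
  by apply/matrixP => i j; rewrite !mxE conjCK.
have AN : A \is normalmx.
  apply/normalmxP; suff -> : (map_mx Num.conj A^T) = A by [].
  by rewrite /A trmx_mul map_mxM map_trmx trmxK cc.
have /orthomx_spectralP AE := AN.
set U := spectralmx A in AE; set D := spectral_diag A in AE *.
have DE : diag_mx D = U *m A *m (map_mx Num.conj U^T) := spectral_diagE AN.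
have D0 i : 0 <= D 0 i.
  have -> : D 0 i = diag_mx D i i by rewrite mxE eqxx mulr1n.
  rewrite DE /A; set V := M *m map_mx Num.conj U^T.
  have -> : U *m (map_mx Num.conj M^T *m M) *m map_mx Num.conj U^T = map_mx Num.conj V^T *m V.
    by rewrite /V trmx_mul map_mxM map_trmx trmxK cc !mulmxA.
  by rewrite mxE; apply: sumr_ge0 => j _; rewrite !mxE mulrC mul_conjC_ge0.
have trD : \sum_i D 0 i = hs2 X.
  have -> : \sum_i D 0 i = \tr A.
    rewrite AE mxtrace_mulC mulmxA mulmxV ?spectral_unit // mul1mx.
    by apply: eq_bigr => i _; rewrite mxE eqxx mulr1n.
  rewrite /mxtrace /hs2 [RHS]sum_enum_val.
  under [RHS]eq_bigr => i _ do rewrite sum_enum_val.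
  rewrite [RHS]exchange_big; apply: eq_bigr => i _; rewrite mxE; apply: eq_bigr => j _.
  by rewrite !mxE normCK mulrC.
have s0 : 0 <= \sum_i sqrtC (D 0 i) by apply: sumr_ge0 => i _; rewrite sqrtC_ge0.
rewrite -[leLHS](sqrCK s0) ler_sqrtC ?nnegrE ?exprn_ge0 ?mulr_ge0 ?ler0n ?hs2_ge0 //.
have := sqr_norm_sum_le (fun i => sqrtC (D 0 i)) (fun _ : 'I_#|I| => @ler01 C).
rewrite sumr_const card_ord; under eq_bigr => i _ do rewrite mul1r.
rewrite ger0_norm // -trD => /le_trans; apply.
apply: ler_wpM2l; rewrite ?ler0n //; apply: ler_sum => i _.
by rewrite mul1r ger0_norm ?sqrtC_ge0 // sqrtCK.
Qed.

End Scalars.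

(** * An informationally complete measurement *)

Section Frame.
Variable C : numClosedFieldType.

Lemma sum_delta (I : finType) (i : I) (F : I -> C) :
  \sum_l (l == i)%:R * F l = F i.
Proof.
rewrite (bigD1 i) //= eqxx mul1r big1 ?addr0 // => l /negPf->.
by rewrite mul0r.
Qed.

Lemma sum_i4 (F : C -> C) :
  \sum_(s < 4) F ('i ^+ s) = F 1 + F 'i + F (-1) + F (- 'i).
Proof.
rewrite !big_ord_recl big_ord0 addr0 /= !addrA; congr (F _ + F _ + F _ + F _).
- exact: sqrCi.
- by rewrite exprS sqrCi mulrN1.
Qed.

Variable d : nat.
Hypothesis d_gt0 : (0 < d)%N.

(** The outer products of the vectors e_i + 'i^s e_j sum to 8d times the identity: in the sum over s
    the cross terms between e_i and e_j cancel for i != j, and each of the two slots contributes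
    4d. *)
Let r : C := sqrtC (8 * d%:R)^-1.

Let r_ge0 : 0 <= r.
Proof. by rewrite sqrtC_ge0 invr_ge0 mulr_ge0 ?ler0n. Qed.

Let rr : r * r = (8 * d%:R)^-1.
Proof. by rewrite -expr2 sqrtCK. Qed.

Let d_neq0 : d%:R != 0 :> C.
Proof. by rewrite pnatr_eq0 -lt0n. Qed.

(* Up to normalisation, the vectors e_i + 'i^s e_j: polarisation recovers every
   entry X i j from the values <psi|X|psi>. *)
Let psi (w : 'I_d * 'I_d * 'I_4) (l : 'I_d) : C :=
  r * ((l == w.1.1)%:R + 'i ^+ w.2 * (l == w.1.2)%:R).

Let psi_resolution l l' : \sum_w (psi w l)^* * psi w l' = (l == l')%:R.
Proof.
have i2 : 'i * 'i = -1 :> C by rewrite -expr2 sqrCi.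
rewrite !sum_pair /psi /=.
transitivity (\sum_(i < d) \sum_(j < d) ((8 * d%:R)^-1 *
   (4 * ((i == l)%:R * (l' == i)%:R + (j == l)%:R * (l' == j)%:R)) : C)).
  apply: eq_bigr => i _; apply: eq_bigr => j _.
  rewrite (sum_i4 (fun u => (r * ((l == i)%:R + u * (l == j)%:R))^* *
    (r * ((l' == i)%:R + u * (l' == j)%:R)))).
  rewrite !rmorphM !rmorphD !rmorphM !rmorph1 !rmorphN /= !rmorph1 conjCi.
  rewrite (CrealP (ger0_real r_ge0)) !conjC_nat !(eq_sym l) -rr.
  move: (i == l)%:R (l' == i)%:R (j == l)%:R (l' == j)%:R => a b c e.
  transitivity (r * r * (4 * (a * b) + 2 * (c * e) - 2 * ('i * 'i) * (c * e))); first by ring.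
  by rewrite i2; ring.
under eq_bigr => i _ do rewrite -!mulr_sumr big_split /= sumr_const sum_delta card_ord.
rewrite -!mulr_sumr big_split /= sumr_const card_ord.
rewrite sumrMnl sum_delta eq_sym -mulrnDl -[(_ + _) *+ d]mulr_natr; field; exact: d_neq0.
Qed.

(** For fixed i and j, a discrete Fourier sum over s isolates [X i j / (2 * d)]. Cauchy-Schwarz over
    the four values of s costs a factor 4, and 4 * (2d)^2 = 16 d^2. *)
Let psi_frame (X : op C 'I_d) :
  hs2 X <= 16 * d%:R ^+ 2 *
    \sum_w `|\sum_l \sum_l' (psi w l)^* * X l l' * psi w l'| ^+ 2.
Proof.
have i2 : 'i * 'i = -1 :> C by rewrite -expr2 sqrCi.
rewrite !sum_pair /hs2 mulr_sumr; apply: ler_sum => i _.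
rewrite mulr_sumr; apply: ler_sum => j _.
pose f (u : C) := (8 * d%:R)^-1 *
  (X i i + u * X i j + u^* * X j i + u^* * u * X j j).
have fE (s : 'I_4) : \sum_l \sum_l' (psi (i, j, s) l)^* * X l l' * psi (i, j, s) l' = f ('i ^+ s).
  rewrite /f -rr /psi /=; set u := _ ^+ _.
  transitivity (\sum_l \sum_l' ((l == i)%:R * ((l' == i)%:R * (r * r * X l l'))
     + (l == i)%:R * ((l' == j)%:R * (r * r * u * X l l'))
     + (l == j)%:R * ((l' == i)%:R * (r * r * u^* * X l l'))
     + (l == j)%:R * ((l' == j)%:R * (r * r * u^* * u * X l l')))).
    apply: eq_bigr => l _; apply: eq_bigr => l' _.
    rewrite !rmorphM !rmorphD !rmorphM /= !conjC_nat (CrealP (ger0_real r_ge0)).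
    by ring.
  under eq_bigr => l _ do rewrite !big_split /= -!mulr_sumr !sum_delta.
  by rewrite !big_split /= !sum_delta; ring.
under eq_bigr => s _ do rewrite fE.
have E : \sum_(s < 4) 1 * (('i ^+ s)^* * f ('i ^+ s)) = (2 * d%:R)^-1 * X i j.
  rewrite (sum_i4 (fun u => 1 * (u^* * f u))) /f !rmorphN /= !rmorph1 conjCi.
  set x := X i i; set y := X i j; set z := X j i; set t := X j j.
  transitivity ((8 * d%:R)^-1 * (2 * (1 - ('i * 'i)) * y + 2 * (1 + 'i * 'i) * z)).
    by ring.
  by rewrite i2; field; exact: d_neq0.
have := sqr_norm_sum_le (fun s : 'I_4 => ('i ^+ s)^* * f ('i ^+ s)) (fun _ => @ler01 C).
rewrite E sumr_const card_ord normrM exprMn.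
rewrite (eq_bigr (fun s : 'I_4 => `|f ('i ^+ s)| ^+ 2)); last first.
  by move=> s _; rewrite mul1r normrM norm_conjC normrX normCi expr1n mul1r.
rewrite ger0_norm ?invr_ge0 ?mulr_ge0 ?ler0n // => h.
have d2V : 0 < (2 * d%:R)^-1 :> C by rewrite invr_gt0 mulr_gt0 ?ltr0n.
rewrite -(ler_pM2l (exprn_gt0 2 d2V)).
apply: le_trans h _; rewrite le_eqVlt; apply/orP; left; apply/eqP.
by field; exact: d_neq0.
Qed.

Lemma frame_exists : exists (W : finType) (psi : W -> 'I_d -> C),
  (forall l l', \sum_w (psi w l)^* * psi w l' = (l == l')%:R) /\
  forall X : op C 'I_d, hs2 X <= 16 * d%:R ^+ 2 *
    \sum_w `|\sum_l \sum_l' (psi w l)^* * X l l' * psi w l'| ^+ 2.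
Proof. by exists ('I_d * 'I_d * 'I_4)%type, psi. Qed.

End Frame.

(** * Martingales over prefixes of outcome strings *)

Section Updates.
Variables (C : numClosedFieldType) (k : nat) (T : finType).
Implicit Types (b : {ffun 'I_k -> T}) (m : 'I_k).

Lemma fupd_same b m c : fupd b m c m = c.
Proof. by rewrite ffunE eqxx. Qed.

Lemma fupd_neq b m c j : j != m -> fupd b m c j = b j.
Proof. by rewrite ffunE => /negPf->. Qed.

Lemma fupd_id b m : fupd b m (b m) = b.
Proof. by apply/ffunP => j; rewrite ffunE; case: eqP => [->|]. Qed.

Lemma fupd_fupd b m c c' : fupd (fupd b m c) m c' = fupd b m c'.
Proof. by apply/ffunP => j; rewrite !ffunE; case: eqP. Qed.

(** Every string with value [c] at [m] arises from exactly #|T| strings, one for each overwritten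
    value. *)
Lemma sum_fupd m c (F : {ffun 'I_k -> T} -> C) :
  \sum_(b : {ffun 'I_k -> T}) F (fupd b m c) = #|T|%:R * \sum_(b : {ffun 'I_k -> T} | b m == c) F b.
Proof.
rewrite (partition_big (fun b => fupd b m c) (fun b : {ffun 'I_k -> T} => b m == c)) /=; last first.
  by move=> b _; rewrite fupd_same.
rewrite mulr_sumr; apply: eq_bigr => b /eqP bm.
rewrite (eq_bigr (fun _ => F b)); last by move=> b' /eqP->.
rewrite (reindex_onto (fun c' => fupd b m c') (fun b' : {ffun 'I_k -> T} => b' m)) /=; last first.
  by move=> b' /eqP <-; rewrite fupd_fupd fupd_id.
rewrite (eq_bigl (fun=> true)) ?sumr_const ?mulr_natl // => c'.
by rewrite fupd_same fupd_fupd -bm fupd_id !eqxx.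
Qed.

Lemma sum_slice m c (F : {ffun 'I_k -> T} -> C) :
  (forall b c', F (fupd b m c') = F b) ->
  \sum_(b : {ffun 'I_k -> T} | b m == c) F b = #|T|%:R^-1 * \sum_b F b.
Proof.
move=> FE; have T0 : #|T|%:R != 0 :> C.
  by rewrite pnatr_eq0 -lt0n; apply/card_gt0P; exists c.
apply: (mulfI T0); rewrite mulVKf // -sum_fupd.
by apply: eq_bigr => b _; rewrite FE.
Qed.

End Updates.

Section Martingale.
Variables (C : numClosedFieldType) (k : nat) (T : finType).
Local Notation Omega := {ffun 'I_k -> T}.
Implicit Types (z : Omega) (g p : Omega -> C).

Definition agree (j : nat) z z' := [forall i : 'I_k, (i < j)%N ==> (z i == z' i)].

Lemma agreeP j z z' :
  reflect (forall i : 'I_k, (i < j)%N -> z i = z' i) (agree j z z').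
Proof.
apply: (iffP forallP) => H i; first by move=> ij; apply/eqP/(implyP (H i)).
by apply/implyP => ij; apply/eqP/H.
Qed.

Lemma agree_refl j z : agree j z z.
Proof. exact/agreeP. Qed.

Lemma agree_sym j z z' : agree j z z' = agree j z' z.
Proof. by apply/agreeP/agreeP => H i ij; rewrite H. Qed.

Lemma agree_eqr j z z' z'' : agree j z z' -> agree j z z'' = agree j z' z''.
Proof.
by move=> /agreeP H; apply/agreeP/agreeP => H' i ij; rewrite -H' // H.
Qed.

Lemma agreeW j z z' : agree j.+1 z z' -> agree j z z'.
Proof. by move=> /agreeP H; apply/agreeP => i ij; apply/H/ltnW. Qed.

Lemma agree_full z z' : agree k z z' = (z' == z).
Proof.
apply/agreeP/eqP => [H|-> //]; apply/ffunP => i.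
by rewrite H ?ltn_ord.
Qed.

(** Positions count from 0, so the first [m] outcomes exclude the one at index [m], while the first
    [m.+1] include it. *)
Lemma agree_fupd (m : 'I_k) z z' c : agree m z (fupd z' m c) = agree m z z'.
Proof.
by apply/agreeP/agreeP => H i im; have := H i im; rewrite fupd_neq //;
  apply: contraL im => /eqP->; rewrite ltnn.
Qed.

Lemma agree_fupdS (m : 'I_k) z z' c :
  agree m.+1 (fupd z m c) z' = agree m z z' && (z' m == c).
Proof.
apply/agreeP/andP => [H|[/agreeP H /eqP Hm] i].
  split; last by rewrite -H // fupd_same.
  apply/agreeP => i im; rewrite -H ?fupd_neq //; last exact: ltnW.
  by apply: contraL im => /eqP->; rewrite ltnn.
rewrite ltnS => im; have [->|ne] := eqVneq i m; first by rewrite fupd_same.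
by rewrite fupd_neq // H // ltn_neqAle im andbT.
Qed.

(* [cls j g / cls j p] is the conditional expectation given the first [j] outcomes,
   when [p] is the outcome distribution and [g] has density [g / p]. *)
Definition cls (j : nat) g z : C := \sum_(z' | agree j z z') g z'.

Lemma cls_eq j g z z' : agree j z z' -> cls j g z = cls j g z'.
Proof. by move=> H; apply: eq_bigl => z''; apply: agree_eqr. Qed.

Lemma cls_full g z : cls k g z = g z.
Proof. by rewrite /cls (eq_bigl _ _ (agree_full z)) big_pred1_eq. Qed.

Lemma cls_split (m : 'I_k) g z : \sum_c cls m.+1 g (fupd z m c) = cls m g z.
Proof.
rewrite /cls [RHS](partition_big (fun z' : Omega => z' m) predT) //=.
by apply: eq_bigr => c _; apply: eq_bigl => z'; rewrite agree_fupdS.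
Qed.

Lemma cls_sum_fupd (m : 'I_k) g z c :
  cls m (fun z' => g (fupd z' m c)) z = #|T|%:R * cls m.+1 g (fupd z m c).
Proof.
have := sum_fupd m c (fun z' => if agree m z z' then g z' else 0).
move=> E.
have -> : cls m.+1 g (fupd z m c) = \sum_(z' : Omega | (z' m == c) && agree m z z') g z'.
  by apply: eq_bigl => z'; rewrite agree_fupdS andbC.
rewrite big_mkcondr -E /cls [LHS]big_mkcond; apply: eq_bigr => z' _.
by rewrite agree_fupd.
Qed.

Lemma cls_mulr j g h z : (forall z', agree j z z' -> h z' = h z) ->
  cls j (fun z => g z * h z) z = cls j g z * h z.
Proof.
by move=> H; rewrite /cls mulr_suml; apply: eq_bigr => z' /H->.
Qed.

Lemma cls_ge0 j p z : (forall z, 0 <= p z) -> 0 <= cls j p z.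
Proof. by move=> p0; apply: sumr_ge0. Qed.

Lemma le_cls j p z : (forall z, 0 <= p z) -> p z <= cls j p z.
Proof.
move=> p0; rewrite /cls (bigD1 z) ?agree_refl //= lerDl; exact: sumr_ge0.
Qed.

Section Weight.
Variable p : Omega -> C.
Hypothesis p_ge0 : forall z, 0 <= p z.

(** Law of total expectation, obtained by exchanging the two sums. Division by 0 gives 0, so [g] has
    to vanish on prefixes of weight 0. *)
Lemma sum_cexp j g : (forall z, cls j p z = 0 -> g z = 0) ->
  \sum_z p z * (cls j g z / cls j p z) = \sum_z g z.
Proof.
move=> g0.
transitivity (\sum_z \sum_(z' | agree j z z') p z * (g z' / cls j p z)).
  by apply: eq_bigr => z _; rewrite {1}/cls mulr_suml mulr_sumr.
rewrite (exchange_big_dep predT) //=; apply: eq_bigr => z' _.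
transitivity (\sum_(z | agree j z' z) p z * (g z' / cls j p z')).
  by apply: eq_big => [z|z H]; [rewrite agree_sym | rewrite (cls_eq p H)].
rewrite -mulr_suml -/(cls j p z'); have [/g0->|n0] := eqVneq (cls j p z') 0.
  by rewrite mul0r mulr0.
by rewrite mulrC divfK.
Qed.

Variable f : Omega -> C.
Hypothesis f_ac : forall z, p z = 0 -> f z = 0.

Definition cexp j z := cls j f z / cls j p z.

Lemma cls_weight_eq0 j z : cls j p z = 0 -> p z = 0.
Proof.
by move=> E; apply/eqP; rewrite eq_le p_ge0 andbT -E le_cls.
Qed.

(** A factor determined by the first [j] outcomes can be moved inside the conditional
    expectation. *)
Lemma sum_cexp_mul j h : (forall z z', agree j z z' -> h z' = h z) ->
  \sum_z p z * (cexp j z * h z) = \sum_z f z * h z.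
Proof.
move=> H; rewrite -(@sum_cexp j (fun z => f z * h z)); last first.
  by move=> z /cls_weight_eq0/f_ac->; rewrite mul0r.
apply: eq_bigr => z _; rewrite cls_mulr; last by move=> z'; apply: H.
by rewrite /cexp mulrAC.
Qed.

Lemma cexp_eq j z z' : agree j z z' -> cexp j z' = cexp j z.
Proof. by move=> H; rewrite /cexp (cls_eq f H) (cls_eq p H). Qed.

(** Pythagoras for martingales: the increment is orthogonal to [cexp m], so both cross terms equal
    the second moment of [cexp m]. *)
Lemma cexp_increment m :
  \sum_z p z * `|cexp m.+1 z - cexp m z| ^+ 2 =
  \sum_z p z * `|cexp m.+1 z| ^+ 2 - \sum_z p z * `|cexp m z| ^+ 2.
Proof.
have E : \sum_z p z * (cexp m.+1 z * (cexp m z)^*) =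
         \sum_z p z * (cexp m z * (cexp m z)^*).
  rewrite !sum_cexp_mul // => z z' H; congr (_^*); apply: cexp_eq => //.
  exact: agreeW.
have Ec : \sum_z p z * ((cexp m.+1 z)^* * cexp m z) =
          \sum_z p z * (cexp m z * (cexp m z)^*).
  have cj z (x y : C) : (p z * (x * y))^* = p z * (x^* * y^*).
    by rewrite !rmorphM /= (CrealP (ger0_real (p_ge0 z))).
  apply: (can_inj (@conjCK C)); rewrite !rmorph_sum /=.
  transitivity (\sum_z p z * (cexp m.+1 z * (cexp m z)^*)).
    by apply: eq_bigr => z _; rewrite cj conjCK.
  by rewrite E; apply: eq_bigr => z _; rewrite cj conjCK; congr (_ * _); rewrite mulrC.
transitivity (\sum_z p z * `|cexp m.+1 z| ^+ 2 + \sum_z p z * `|cexp m z| ^+ 2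
   - \sum_z p z * (cexp m.+1 z * (cexp m z)^*) - \sum_z p z * ((cexp m.+1 z)^* * cexp m z)).
  rewrite -!sumrN -!big_split /=; apply: eq_bigr => z _.
  by rewrite !normCK rmorphB /=; ring.
rewrite E Ec (eq_bigr _ (fun z _ => congr1 (fun x => p z * x) (normCK (cexp m z)))).
by ring.
Qed.

End Weight.

Variables (I : finType) (K : Omega -> op C I).
Hypothesis K_psd : forall z, psd (K z).

Let p z := tr (K z).

Let p_ge0 z : 0 <= p z.
Proof. exact: tr_ge0. Qed.

(* The conditional state of A given the first [j] outcomes; it is 0 on prefixes of
   probability 0. *)
Definition rho j z : op C I := fun a a' => cexp p (fun z => K z a a') j z.

Definition increment j z : C := hs2 (fun a a' => rho j.+1 z a a' - rho j z a a').

Lemma rho_eq j z z' a a' : agree j z z' -> rho j z' a a' = rho j z a a'.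
Proof. exact: cexp_eq. Qed.

(** The second moments [Phi] telescope to [Phi k - Phi 0], and [Phi k] is at most the total weight
    because a state has squared Hilbert-Schmidt norm at most 1. *)
Lemma sum_increment_le : \sum_(m < k) \sum_z p z * increment m z <= \sum_z p z.
Proof.
pose Phi j := \sum_z p z * hs2 (rho j z).
have sumE (F : Omega -> op C I) : \sum_z p z * hs2 (F z) =
    \sum_a \sum_a' \sum_z p z * `|F z a a'| ^+ 2.
  under eq_bigr => z _ do rewrite mulr_sumr.
  rewrite exchange_big; apply: eq_bigr => a _ /=.
  under eq_bigr => z _ do rewrite mulr_sumr.
  by rewrite exchange_big.
have step j : \sum_z p z * increment j z = Phi j.+1 - Phi j.
  rewrite /Phi !sumE -sumrB; apply: eq_bigr => a _.
  rewrite -sumrB; apply: eq_bigr => a' _; apply: cexp_increment => // z.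
  exact: psd_tr_eq0.
under eq_bigr => m _ do rewrite step.
rewrite -(big_mkord predT (fun m => Phi m.+1 - Phi m)) telescope_sumr //.
rewrite lerBlDr; apply: (@le_trans _ _ (\sum_z p z)); last first.
  by rewrite lerDl; apply: sumr_ge0 => z _; rewrite mulr_ge0 ?hs2_ge0.
apply: ler_sum => z _; rewrite -[leRHS]mulr1 ler_wpM2l //.
(* Once all k outcomes are fixed, a class is a single string and the conditional state is
   [K z / p z]. *)
have -> : hs2 (rho k z) = hs2 (K z) / p z ^+ 2.
  rewrite /hs2 mulr_suml; apply: eq_bigr => a _; rewrite mulr_suml.
  apply: eq_bigr => a' _; rewrite /rho /cexp !cls_full normrM exprMn normfV.
  by rewrite (ger0_norm (p_ge0 z)) exprVn.
have [->|n0] := eqVneq (p z) 0; first by rewrite expr0n invr0 mulr0 ler01.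
have p2 : 0 < p z ^+ 2 by rewrite exprn_gt0 // lt_def n0 p_ge0.
by rewrite ler_pdivrMr // mul1r; apply: hs2_le_sqr_tr.
Qed.

(** Pigeonhole: if all k expected increments exceeded the average bound, their sum would violate
    [sum_increment_le]. *)
Lemma exists_small_increment : (0 < k)%N ->
  exists m : 'I_k, \sum_z p z * increment m z <= (\sum_z p z) / k%:R.
Proof.
move=> k0; apply/existsP; apply: contraT => /existsPn H.
have s0 : 0 <= \sum_z p z by apply: sumr_ge0.
have lt m : (\sum_z p z) / k%:R < \sum_z p z * increment (m : 'I_k) z.
  have := H m; rewrite real_ltNge //; apply: ger0_real.
    by rewrite divr_ge0 ?ler0n.
  by apply: sumr_ge0 => z _; rewrite mulr_ge0 ?hs2_ge0.
have : \sum_(m < k) (\sum_z p z) / k%:R < \sum_(m < k) \sum_z p z * increment m z.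
  apply: ltr_sum => //; apply/hasP; exists (Ordinal k0); rewrite ?mem_index_enum //.
rewrite sumr_const card_ord -[(_ / _) *+ k]mulr_natr divfK ?pnatr_eq0 -?lt0n //.
by move=> /lt_le_trans /(_ sum_increment_le); rewrite ltxx.
Qed.

End Martingale.

(** * Positivity of tensor products *)

Section Tensor.
Variable C : numClosedFieldType.

(** The vectors [u l] are the eigenvectors of X scaled by the square roots of the eigenvalues. *)
Lemma psd_factor (I : finType) (X : op C I) : psd X ->
  exists u : 'I_#|I| -> I -> C, forall a a', X a a' = \sum_l u l a * (u l a')^*.
Proof.
move=> X0; pose A := mx_of_op X.
have AN : A \is normalmx.
  apply/normalmxP; suff -> : (map_mx Num.conj A^T) = A by [].
  by apply/matrixP => i j; rewrite !mxE; apply/esym/psd_herm.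
have /orthomx_spectralP AE := AN.
set U := spectralmx A in AE; set D := spectral_diag A in AE.
have UU : U \is unitarymx by apply: spectral_unitarymx.
have DE : diag_mx D = U *m A *m (map_mx Num.conj U^T) := spectral_diagE AN.
have D0 i : 0 <= D 0 i.
  have -> : D 0 i = diag_mx D i i by rewrite mxE eqxx mulr1n.
  (* An eigenvalue is the value of the form at its unit eigenvector, hence nonnegative. *)
  have := X0 (fun a => (U i (enum_rank a))^*).
  rewrite sum_enum_val DE mxE; congr (0 <= _).
  under eq_bigr => j _ do rewrite sum_enum_val.
  rewrite exchange_big; apply: eq_bigr => j _ /=; rewrite !mxE mulr_suml.
  by apply: eq_bigr => l _; rewrite !mxE !enum_valK conjCK.
exists (fun l a => sqrtC (D 0 l) * (U l (enum_rank a))^*) => a a'.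
have -> : X a a' = A (enum_rank a) (enum_rank a') by rewrite mxE !enum_rankK.
rewrite {1}AE invmx_unitary // mxE; apply: eq_bigr => l _.
rewrite mul_mx_diag !mxE rmorphM /= conjCK.
rewrite (CrealP (ger0_real (_ : 0 <= sqrtC (D 0 l)))) ?sqrtC_ge0 //.
by rewrite -{1}(sqrtCK (D 0 l)); ring.
Qed.

(** Splitting X into rank-one terms turns the form of the tensor product into a sum of values of the
    form of Y, at the partial contractions [vl l] of v. *)
Lemma psd_tens (I J : finType) (X : op C I) (Y : op C J) :
  psd X -> psd Y -> psd (op_tens X Y).
Proof.
move=> /psd_factor[u uE] Y0 v.
pose vl l b := \sum_a (u l a)^* * v (a, b).
suff -> : \sum_i \sum_j (v i)^* * op_tens X Y i j * v j =
    \sum_l \sum_b \sum_b' (vl l b)^* * Y b b' * vl l b'.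
  by apply: sumr_ge0 => l _; apply: Y0.
transitivity (\sum_l \sum_b \sum_b' \sum_a \sum_a'
    ((v (a, b))^* * (u l a * (u l a')^* * Y b b') * v (a', b'))).
  rewrite sum_pair; under eq_bigr => a _ do under eq_bigr => b _ do rewrite sum_pair.
  rewrite exchange_big /= [RHS]exchange_big /=; apply: eq_bigr => b _.
  under eq_bigr => a _ do rewrite exchange_big /=.
  rewrite exchange_big /= [RHS]exchange_big /=; apply: eq_bigr => b' _.
  rewrite [RHS]exchange_big /=; apply: eq_bigr => a _.
  rewrite [RHS]exchange_big /=; apply: eq_bigr => a' _.
  by rewrite /op_tens uE mulr_suml mulr_sumr mulr_suml.
apply: eq_bigr => l _; apply: eq_bigr => b _; apply: eq_bigr => b' _.
rewrite /vl rmorph_sum !mulr_suml; apply: eq_bigr => a _.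
rewrite mulr_sumr; apply: eq_bigr => a' _.
by rewrite !rmorphM /= conjCK; ring.
Qed.

End Tensor.

(** * Rounding to a one-way LOCC measurement *)

(* [K z] is the (unnormalised) state of A after all the B_i are measured with outcome
   [z]; [tau z y] is the same with B_m left unmeasured and carrying the label [y]. *)
Section Rounding.
Variables (C : numClosedFieldType) (k dA d : nat) (Y W : finType).
Hypothesis d_gt0 : (0 < d)%N.
Local Notation A := 'I_dA.
Local Notation B := 'I_d.
Local Notation Omega := {ffun 'I_k -> Y * W}.

Variable psi : W -> B -> C.
Hypothesis psi_resolution :
  forall l l', \sum_w (psi w l)^* * psi w l' = (l == l')%:R.
Hypothesis psi_frame : forall X : op C B, hs2 X <= 16 * d%:R ^+ 2 *
    \sum_w `|\sum_l \sum_l' (psi w l)^* * X l l' * psi w l'| ^+ 2.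

Variable P : Y -> op C (A * B)%type.
Hypothesis P_povm : is_povm P.
Variable y0 : Y.

Variables (m : 'I_k) (K : Omega -> op C A) (tau : Omega -> Y -> op C (A * B)%type).
Hypothesis K_psd : forall z, psd (K z).
Hypothesis tau_psd : forall z y, psd (tau z y).
Hypothesis tau_measured : forall z y w a a',
  \sum_b \sum_b' (psi w b)^* * tau z y (a, b) (a', b') * psi w b' =
  #|{: Y * W}|%:R^-1 * K (fupd z m (y, w)) a a'.
Hypothesis tau_sum : forall y i j, \sum_z tau z y i j = d%:R^-1 * P y i j.
Hypothesis tau_nosignal : forall z b b',
  \sum_y \sum_a tau z y (a, b) (a, b') =
  (b == b')%:R * (d%:R^-1 * \sum_c \sum_y \sum_a tau z y (a, c) (a, c)).

Let d_neq0 : d%:R != 0 :> C.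
Proof. by rewrite pnatr_eq0 -lt0n. Qed.

Let p z := tr (K z).
Let pm z := cls m p z.
(** The joint operator of A and (B_m, y_m) given the first [m] outcomes, before division by their
    weight [pm z]. [K1] and [p1] are the operator of A and the weight once outcome [m] is also
    known. *)
Let Tm z y : op C (A * B)%type := fun i j => cls m (fun z => tau z y i j) z.
Let K1 z : op C A := fun a a' => cls m.+1 (fun z => K z a a') z.
Let p1 z := cls m.+1 p z.

Let p_ge0 z : 0 <= p z.
Proof. exact: tr_ge0. Qed.

Let pm_ge0 z : 0 <= pm z.
Proof. exact: cls_ge0. Qed.

Let sum_resolution (F : B -> B -> C) :
  \sum_w \sum_b \sum_b' (psi w b)^* * F b b' * psi w b' = \sum_b F b b.
Proof.
rewrite exchange_big; apply: eq_bigr => b _ /=.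
rewrite exchange_big -[RHS](sum_delta b (F b)) /=; apply: eq_bigr => b' _.
rewrite eq_sym -psi_resolution mulr_suml; apply: eq_bigr => w _.
by ring.
Qed.

Let Tm_psd z y : psd (Tm z y).
Proof. exact: psd_sum. Qed.

Let K1_psd z : psd (K1 z).
Proof. exact: psd_sum. Qed.

Let tr_cls j (X : Omega -> op C A) z :
  \sum_a cls j (fun z => X z a a) z = cls j (fun z => tr (X z)) z.
Proof. by rewrite exchange_big. Qed.

Let card_neq0 (c : Y * W) : #|{: Y * W}|%:R != 0 :> C.
Proof. by rewrite pnatr_eq0 -lt0n; apply/card_gt0P; exists c. Qed.

Let Tm_measured z y w a a' :
  \sum_b \sum_b' (psi w b)^* * Tm z y (a, b) (a', b') * psi w b' =
  K1 (fupd z m (y, w)) a a'.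
Proof.
apply: (mulfI (card_neq0 (y, w))); rewrite -cls_sum_fupd.
transitivity (\sum_(z' | agree m z z') #|{: Y * W}|%:R *
   \sum_b \sum_b' (psi w b)^* * tau z' y (a, b) (a', b') * psi w b').
  rewrite -mulr_sumr; congr (_ * _); rewrite [RHS]exchange_big; apply: eq_bigr => b _ /=.
  rewrite [RHS]exchange_big; apply: eq_bigr => b' _ /=.
  by rewrite /Tm /cls mulr_sumr mulr_suml.
by apply: eq_bigr => z' _; rewrite tau_measured mulVKf // (card_neq0 (y, w)).
Qed.

(** Tracing out B_m is the same as measuring it and summing over w; summing over the outcome at [m]
    then gives the weight of the prefix. *)
Let Tm_trace z : \sum_c \sum_y \sum_a Tm z y (a, c) (a, c) = pm z.
Proof.
rewrite exchange_big /=; under eq_bigr => y _ do rewrite exchange_big /=.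
transitivity (\sum_y \sum_w \sum_a K1 (fupd z m (y, w)) a a).
  apply: eq_bigr => y _; rewrite [RHS]exchange_big; apply: eq_bigr => a _ /=.
  under [RHS]eq_bigr => w _ do rewrite -Tm_measured.
  by rewrite sum_resolution.
rewrite -(sum_pair (fun c => \sum_a K1 (fupd z m c) a a)) /pm -cls_split.
by apply: eq_bigr => c _; rewrite tr_cls.
Qed.

Let Tm_nosignal z b b' :
  \sum_y \sum_a Tm z y (a, b) (a, b') = (b == b')%:R * (pm z / d%:R).
Proof.
have ex b1 b2 : \sum_y \sum_a Tm z y (a, b1) (a, b2) =
    \sum_(z' | agree m z z') \sum_y \sum_a tau z' y (a, b1) (a, b2).
  rewrite [RHS]exchange_big; apply: eq_bigr => y _ /=.
  by rewrite [RHS]exchange_big.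
rewrite -Tm_trace; under [in RHS]eq_bigr => c _ do rewrite ex.
rewrite [in RHS]exchange_big ex mulr_suml mulr_sumr /=.
by apply: eq_bigr => z' _; rewrite tau_nosignal [in RHS](mulrC _ _^-1).
Qed.

(** The traces of the [tau z' y'], over all labels and all strings of the class, are nonnegative and
    add up to [pm z]. *)
Let pm0_tau z y i j : pm z = 0 -> tau z y i j = 0.
Proof.
move=> pm0; apply: psd_tr_eq0 => //.
have tT y' : tr (Tm z y') = cls m (fun z => tr (tau z y')) z by rewrite /tr exchange_big.
have s0 : \sum_y tr (Tm z y) = 0.
  rewrite -[RHS]pm0 -Tm_trace [RHS]exchange_big; apply: eq_bigr => y' _ /=.
  by rewrite /tr sum_pair exchange_big.
have {}s0 : tr (Tm z y) = 0.
  by move/psumr_eq0P: s0 => -> // y' _; apply: tr_ge0.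
apply/eqP; rewrite eq_le tr_ge0 // andbT -s0 tT.
by apply: (@le_cls _ _ _ m (fun z => tr (tau z y))) => z'; apply: tr_ge0.
Qed.

(** Sorting by the outcome at [m] brings in [tau_sum]. Summing over w traces out B, which yields d
    times the identity on A and cancels 1/d. Hence [K] is itself a POVM on A, the one used by the
    rounded measurement. *)
Let K_sum a a' : \sum_z K z a a' = (a == a')%:R.
Proof.
rewrite (partition_big (fun z : Omega => z m) predT) //=.
transitivity (\sum_y \sum_w \sum_b \sum_b'
    (psi w b)^* * (d%:R^-1 * P y (a, b) (a', b')) * psi w b').
  rewrite sum_pair; apply: eq_bigr => y _; apply: eq_bigr => w _.
  apply: (mulfI (card_neq0 (y, w))).
  rewrite -(sum_fupd m (y, w) (fun z => K z a a')).
  transitivity (\sum_z #|{: Y * W}|%:R *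
    \sum_b \sum_b' (psi w b)^* * tau z y (a, b) (a', b') * psi w b').
    by apply: eq_bigr => z _; rewrite tau_measured mulVKf // (card_neq0 (y, w)).
  rewrite -mulr_sumr; congr (_ * _); rewrite exchange_big; apply: eq_bigr => b _ /=.
  rewrite exchange_big; apply: eq_bigr => b' _ /=.
  by rewrite -tau_sum mulr_sumr mulr_suml.
under eq_bigr => y _ do rewrite (sum_resolution (fun b b' => d%:R^-1 * P y (a, b) (a', b'))).
rewrite exchange_big /=.
under eq_bigr => b _ do rewrite -mulr_sumr (P_povm.2 (a, b) (a', b)) /op1 xpair_eqE eqxx andbT.
by rewrite sumr_const card_ord -[_ *+ d]mulr_natl mulVKf.
Qed.

Lemma sum_tr_outcomes : \sum_z tr (K z) = dA%:R.
Proof.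
rewrite /tr exchange_big /=; under eq_bigr => a _ do rewrite K_sum eqxx.
by rewrite sumr_const card_ord.
Qed.

(** The conditional POVM on B given the first [m] outcomes, normalised by [Tm_nosignal]. On prefixes
    of weight 0 it always answers [y0], so as to remain a POVM. *)
Let F z y : op C B := fun b b' =>
  if pm z == 0 then (y == y0)%:R * (b == b')%:R
  else d%:R / pm z * \sum_a Tm z y (a, b) (a, b').

Definition rounded y : op C (A * B)%type :=
  fun i j => \sum_z op_tens (K z) (F z y) i j.

Let F_povm z : is_povm (F z).
Proof.
rewrite /F; have [pm0|pm0] := eqVneq (pm z) 0; split.
- move=> y; apply: psd_scale; [exact: ler0n | exact: psd_op1].
- by move=> b b'; rewrite (sum_delta y0 (fun _ => (b == b')%:R)).
- move=> y; apply: psd_scale; first by rewrite divr_ge0 ?ler0n.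
  exact: psd_trA.
- move=> b b'; rewrite -mulr_sumr Tm_nosignal /op1.
  by field; rewrite pm0 d_neq0.
Qed.

Lemma rounded_1WL : in_1WL rounded.
Proof. by exists Omega, K, F; do !split => //; exact: K_sum. Qed.

Lemma rounded_povm : is_povm rounded.
Proof.
split=> [y|[a b] [a' b']].
  by apply: psd_sum => z; apply: psd_tens => //; case: (F_povm z).
rewrite /rounded exchange_big /op_tens /=.
under eq_bigr => z _ do rewrite -mulr_sumr (F_povm z).2.
by rewrite -mulr_suml K_sum /op1 xpair_eqE -mulnb natrM.
Qed.

Let R z : op C A := rho K m z.

(** The deviation, at label y, of the conditional joint state of A and (B_m, y_m) from a product. *)
Let Delta y z : op C (A * B)%type := fun i j =>
  (Tm z y i j - R z i.1 j.1 * \sum_a Tm z y (a, i.2) (a, j.2)) / pm z.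

Let pm0_p z : pm z = 0 -> p z = 0.
Proof. exact: cls_weight_eq0. Qed.

Let F_eq z z' y b b' : agree m z z' -> F z' y b b' = F z y b b'.
Proof.
move=> H; rewrite /F /pm (cls_eq p H); case: ifP => // _; congr (_ * _).
by apply: eq_bigr => a _; rewrite /Tm (cls_eq _ H).
Qed.

(** Both terms become [p]-averages of functions of the prefix: P by the law of total expectation for
    [tau], and [rounded] because [F] reads only the first [m] outcomes, so that [K] may be replaced
    by its conditional expectation [R]. *)
Let P_rounded y i j :
  P y i j - rounded y i j = \sum_z p z * (d%:R * Delta y z i j).
Proof.
have -> : P y i j = \sum_z p z * (d%:R * (Tm z y i j / pm z)).
  transitivity (d%:R * \sum_z p z * (Tm z y i j / pm z)); last first.
    by rewrite mulr_sumr; apply: eq_bigr => z _; rewrite mulrCA.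
  rewrite sum_cexp // => [|z pm0]; last exact: pm0_tau.
  by rewrite tau_sum mulVKf.
have -> : rounded y i j = \sum_z p z * (R z i.1 j.1 * F z y i.2 j.2).
  rewrite sum_cexp_mul // => [z /psd_tr_eq0|z z' H]; first exact.
  exact: F_eq.
rewrite -sumrB; apply: eq_bigr => z _; rewrite -mulrBr /Delta /F.
have [/pm0_p->|pm0] := eqVneq (pm z) 0; first by rewrite !mul0r.
by congr (_ * _); field.
Qed.

(** Measuring B_m with result w updates the state of A from [rho K m] to [rho K m.+1]; the prefactor
    is the conditional probability of the outcome (y, w). *)
Let Delta_measured y z w a a' :
  \sum_b \sum_b' (psi w b)^* * Delta y z (a, b) (a', b') * psi w b' =
  p1 (fupd z m (y, w)) / pm z *
  (rho K m.+1 (fupd z m (y, w)) a a' - rho K m (fupd z m (y, w)) a a').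
Proof.
set z1 := fupd _ _ _.
have -> : rho K m z1 a a' = R z a a'.
  by apply: rho_eq; rewrite agree_fupd agree_refl.
transitivity ((\sum_b \sum_b' (psi w b)^* * Tm z y (a, b) (a', b') * psi w b'
  - R z a a' * \sum_a0 \sum_b \sum_b' (psi w b)^* * Tm z y (a0, b) (a0, b') * psi w b') / pm z).
  rewrite [X in (_ - _ * X) / _]exchange_big mulr_sumr -sumrB mulr_suml; apply: eq_bigr => b _ /=.
  rewrite [X in (_ - _ * X) / _]exchange_big mulr_sumr -sumrB mulr_suml; apply: eq_bigr => b' _ /=.
  by rewrite /Delta -mulr_suml -mulr_sumr /=; ring.
rewrite Tm_measured; under eq_bigr => a0 _ do rewrite Tm_measured.
rewrite tr_cls -/z1 -/(p1 z1).
have -> : K1 z1 a a' = p1 z1 * rho K m.+1 z1 a a'.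
  rewrite /rho /cexp -/(K1 z1 a a') -/(p1 z1).
  have [E|n0] := eqVneq (p1 z1) 0; last by rewrite mulrC divfK.
  by rewrite E mul0r; apply: psd_tr_eq0 => //; rewrite -[RHS]E /p1 -tr_cls.
by ring.
Qed.

Let p1_le z c : p1 (fupd z m c) <= pm z.
Proof.
rewrite /pm -cls_split (bigD1 c) //= lerDl; apply: sumr_ge0 => c' _.
exact: cls_ge0.
Qed.

(** The frame bound is applied to each block (a, a'). Of the squared conditional probability
    [r ^+ 2] only one factor is kept, using r <= 1, so that the weights are again those of a
    conditional expectation. *)
Let hs2_Delta y z : hs2 (Delta y z) <= 16 * d%:R ^+ 2 *
  \sum_w p1 (fupd z m (y, w)) / pm z * increment K m (fupd z m (y, w)).
Proof.
have -> : hs2 (Delta y z) =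
    \sum_a \sum_a' hs2 (fun b b' => Delta y z (a, b) (a', b')).
  rewrite /hs2 sum_pair; apply: eq_bigr => a _.
  rewrite [RHS]exchange_big; apply: eq_bigr => b _ /=.
  by rewrite sum_pair.
apply: (@le_trans _ _ (\sum_a \sum_a' 16 * d%:R ^+ 2 * \sum_w
   `|p1 (fupd z m (y, w)) / pm z * (rho K m.+1 (fupd z m (y, w)) a a' -
     rho K m (fupd z m (y, w)) a a')| ^+ 2)).
  apply: ler_sum => a _; apply: ler_sum => a' _.
  apply: le_trans (psi_frame _) _.
  rewrite le_eqVlt; apply/orP; left; apply/eqP; congr (_ * _).
  by apply: eq_bigr => w _; rewrite Delta_measured.
under eq_bigr => a _ do rewrite -mulr_sumr exchange_big /=.
rewrite -mulr_sumr exchange_big; apply: ler_wpM2l.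
  by rewrite mulr_ge0 ?exprn_ge0 ?ler0n.
apply: ler_sum => w _ /=; set z1 := fupd _ _ _; set r := p1 z1 / pm z.
have r0 : 0 <= r by rewrite divr_ge0 ?cls_ge0.
have r1 : r <= 1.
  rewrite /r; have [->|n0] := eqVneq (pm z) 0; first by rewrite invr0 mulr0 ler01.
  by rewrite ler_pdivrMr ?mul1r ?p1_le // lt_def n0 pm_ge0.
rewrite /increment /hs2 mulr_sumr; apply: ler_sum => a _.
rewrite mulr_sumr; apply: ler_sum => a' _.
rewrite normrM exprMn (ger0_norm r0); apply: ler_wpM2r; first exact: exprn_ge0.
by rewrite expr2 ler_piMr.
Qed.

(** Jensen's inequality in [P_rounded], with total weight dA, gives the factors dA and d^2;
    [hs2_Delta] contributes 16 d^2. The remaining sum is bounded by the expected increment. *)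
Lemma hs2_rounded y :
  hs2 (fun i j => P y i j - rounded y i j) <=
  16 * d%:R ^+ 4 * dA%:R * \sum_z tr (K z) * increment K m z.
Proof.
apply: (@le_trans _ _ (dA%:R * \sum_z p z * (d%:R ^+ 2 * hs2 (Delta y z)))).
  rewrite -sum_tr_outcomes -/p; set S := \sum_z p z.
  apply: (@le_trans _ _ (\sum_i \sum_j S * \sum_z p z * `|d%:R * Delta y z i j| ^+ 2)).
    apply: ler_sum => i _; apply: ler_sum => j _.
    by rewrite P_rounded; apply: sqr_norm_sum_le.
  under eq_bigr => i _ do rewrite -mulr_sumr exchange_big /=.
  rewrite -mulr_sumr exchange_big /= le_eqVlt; apply/orP; left; apply/eqP.
  congr (_ * _); apply: eq_bigr => z _.
  rewrite /hs2 !mulr_sumr; apply: eq_bigr => i _.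
  rewrite !mulr_sumr; apply: eq_bigr => j _.
  by rewrite normrM exprMn (ger0_norm (ler0n _ d)).
have pos : 0 <= 16 * d%:R ^+ 4 * dA%:R :> C by rewrite !mulr_ge0 ?exprn_ge0 ?ler0n.
(* The expected increment is rewritten as the mean of its conditional expectation given the first
   [m] outcomes. *)
apply: (@le_trans _ _ (16 * d%:R ^+ 4 * dA%:R * \sum_z p z *
   (cls m (fun z => p z * increment K m z) z / pm z))); last first.
  rewrite sum_cexp // => z /pm0_p->; exact: mul0r.
rewrite !mulr_sumr; apply: ler_sum => z _.
apply: (@le_trans _ _ (dA%:R * (p z * (d%:R ^+ 2 * (16 * d%:R ^+ 2 *
  \sum_w p1 (fupd z m (y, w)) / pm z * increment K m (fupd z m (y, w))))))).
  by do 3?[apply: ler_wpM2l; rewrite ?exprn_ge0 ?ler0n //].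
have -> : dA%:R * (p z * (d%:R ^+ 2 * (16 * d%:R ^+ 2 *
  \sum_w p1 (fupd z m (y, w)) / pm z * increment K m (fupd z m (y, w)))))
  = 16 * d%:R ^+ 4 * dA%:R * (p z *
  \sum_w p1 (fupd z m (y, w)) / pm z * increment K m (fupd z m (y, w))) by ring.
do 2?[apply: ler_wpM2l => //].
(* The conditional expectation runs over all labels; only the terms with label [y] are kept for the
   lower bound. *)
rewrite -cls_split sum_pair (bigD1 y) //= mulrDl mulr_suml ler_wpDr //.
  rewrite divr_ge0 //; do 2![apply: sumr_ge0 => ? _]; apply: cls_ge0 => z'.
  by rewrite mulr_ge0 ?hs2_ge0.
apply: ler_sum => w _; rewrite (@cls_mulr _ _ _ _ _ (increment K m)) -/(p1 _).
  by rewrite mulrAC.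
move=> z' H; rewrite /increment /hs2; apply: eq_bigr => a _; apply: eq_bigr => a' _.
by rewrite (rho_eq _ _ _ H) (rho_eq _ _ _ (agreeW H)).
Qed.

End Rounding.

(** * Measuring the extension *)

Section Measurement.
Variables (C : numClosedFieldType) (k dA d : nat) (Y W : finType).
Hypothesis d_gt0 : (0 < d)%N.
Local Notation B := 'I_d.
Local Notation Bk := {ffun 'I_k -> B}.
Local Notation Omega := {ffun 'I_k -> Y * W}.

Variable psi : W -> B -> C.
Hypothesis psi_resolution :
  forall l l', \sum_w (psi w l)^* * psi w l' = (l == l')%:R.

Variables (P : Y -> op C ('I_dA * B)%type).
Variable G : {ffun 'I_k -> Y} -> op C (ext_idx dA d k).
Hypothesis G_psd : forall ys, psd (G ys).
Hypothesis G_marginal : forall m y (i j : ext_idx dA d k),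
  \sum_(ys : {ffun 'I_k -> Y} | ys m == y) G ys i j =
  P y (i.1, i.2 m) (j.1, j.2 m) * [forall l, (l != m) ==> (i.2 l == j.2 l)]%:R.
Hypothesis G_nosignal : forall m (yf : {ffun 'I_k -> Y}) (b b' : Bk),
  \sum_(ys : {ffun 'I_k -> Y} | [forall l, (l != m) ==> (ys l == yf l)])
     \sum_(a : 'I_dA) G ys (a, b) (a, b') =
  d%:R^-1 * (b m == b' m)%:R *
  \sum_(ys : {ffun 'I_k -> Y} | [forall l, (l != m) ==> (ys l == yf l)])
    \sum_(a : 'I_dA) \sum_(c : B) G ys (a, fupd b m c) (a, fupd b' m c).

Let d_neq0 : d%:R != 0 :> C.
Proof. by rewrite pnatr_eq0 -lt0n. Qed.

Let labels (z : Omega) : {ffun 'I_k -> Y} := [ffun i => (z i).1].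
Let Psi (z : Omega) (b : Bk) : C := \prod_i psi (z i).2 (b i).
Let Psim m (z : Omega) (b : Bk) : C := \prod_(i | i != m) psi (z i).2 (b i).

(** Each B_i is contracted with a vector [psi w]. These vectors resolve the identity, of trace d, so
    one factor 1/d per system makes the operators sum to the identity on A when G is a POVM. *)
Definition measured (z : Omega) : op C 'I_dA := fun a a' =>
  d%:R^-1 ^+ k * \sum_b \sum_b' (Psi z b)^* * G (labels z) (a, b) (a', b') * Psi z b'.

(* The entry [z m] is ignored, whence the factor 1/|Y x W|. *)
Definition unmeasured m (z : Omega) (y : Y) : op C ('I_dA * B)%type := fun i j =>
  d%:R^-1 ^+ k * #|{: Y * W}|%:R^-1 *
  \sum_(b : Bk | b m == i.2) \sum_(b' : Bk | b' m == j.2)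
    (Psim m z b)^* * G (fupd (labels z) m y) (i.1, b) (j.1, b') * Psim m z b'.

Lemma sum_by_value (T : finType) (m : 'I_k) (H : {ffun 'I_k -> T} -> T -> C) :
  \sum_(b : {ffun 'I_k -> T}) H b (b m) = \sum_c \sum_(b : {ffun 'I_k -> T} | b m == c) H b c.
Proof.
rewrite (partition_big (fun b : {ffun 'I_k -> T} => b m) predT) //=.
by apply: eq_bigr => c _; apply: eq_bigr => b /eqP->.
Qed.

Lemma measured_psd z : psd (measured z).
Proof.
apply: psd_scale; first by rewrite exprn_ge0 // invr_ge0 ler0n.
move=> v; have := G_psd (labels z) (fun i => v i.1 * Psi z i.2).
rewrite sum_pair; congr (0 <= _); apply: eq_bigr => a _.
transitivity (\sum_b \sum_a' \sum_b'
  ((v a * Psi z b)^* * G (labels z) (a, b) (a', b') * (v a' * Psi z b'))).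
  by apply: eq_bigr => b _; rewrite sum_pair.
rewrite exchange_big; apply: eq_bigr => a' _ /=.
rewrite mulr_sumr mulr_suml; apply: eq_bigr => b _.
rewrite mulr_sumr mulr_suml; apply: eq_bigr => b' _.
by rewrite rmorphM /=; ring.
Qed.

(** The form is that of G at the vector v on A B_m tensored with the measurement vectors on the
    other systems, up to a nonnegative factor. *)
Lemma unmeasured_psd m z y : psd (unmeasured m z y).
Proof.
apply: psd_scale; first by rewrite mulr_ge0 ?exprn_ge0 ?invr_ge0 ?ler0n.
set ys := fupd _ _ _.
move=> v; have := G_psd ys (fun i => v (i.1, i.2 m) * Psim m z i.2).
rewrite !sum_pair; congr (0 <= _); apply: eq_bigr => a _.
rewrite (sum_by_value m (fun b c => \sum_(j : ext_idx dA d k)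
   (v (a, c) * Psim m z b)^* * G ys (a, b) j *
   (v (j.1, j.2 m) * Psim m z j.2))).
apply: eq_bigr => c _; rewrite sum_pair.
under eq_bigr => b _ do rewrite sum_pair.
rewrite exchange_big; apply: eq_bigr => a' _ /=.
under eq_bigr => b _ do rewrite (sum_by_value m (fun b' c' => (v (a, c) * Psim m z b)^* *
   G ys (a, b) (a', b') * (v (a', c') * Psim m z b'))).
rewrite exchange_big; apply: eq_bigr => c' _ /=.
rewrite mulr_sumr mulr_suml; apply: eq_bigr => b _.
rewrite mulr_sumr mulr_suml; apply: eq_bigr => b' _.
by rewrite rmorphM /=; ring.
Qed.

Lemma unmeasured_measured m z y w a a' :
  \sum_b \sum_b' (psi w b)^* * unmeasured m z y (a, b) (a', b') * psi w b' =
  #|{: Y * W}|%:R^-1 * measured (fupd z m (y, w)) a a'.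
Proof.
have -> : measured (fupd z m (y, w)) a a' = d%:R^-1 ^+ k * \sum_(b : Bk) \sum_(b' : Bk)
    (psi w (b m) * Psim m z b)^* * G (fupd (labels z) m y) (a, b) (a', b') *
    (psi w (b' m) * Psim m z b').
  have PE b : Psi (fupd z m (y, w)) b = psi w (b m) * Psim m z b.
    rewrite /Psi (bigD1 m) //= fupd_same; congr (_ * _).
    by apply: eq_bigr => i im; rewrite fupd_neq.
  have -> : fupd (labels z) m y = labels (fupd z m (y, w)).
    by apply/ffunP => i; rewrite !ffunE; case: ifP.
  by congr (_ * _); apply: eq_bigr => b _; apply: eq_bigr => b' _; rewrite !PE.
rewrite mulrCA mulrA mulr_sumr (sum_by_value m (fun b c => d%:R^-1 ^+ k * #|{: Y * W}|%:R^-1 *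
  \sum_(b' : Bk) (psi w c * Psim m z b)^* * G (fupd (labels z) m y) (a, b) (a', b') *
    (psi w (b' m) * Psim m z b'))).
apply: eq_bigr => c _.
under [RHS]eq_bigr => b _ do rewrite (sum_by_value m (fun b' c' => (psi w c * Psim m z b)^* *
  G (fupd (labels z) m y) (a, b) (a', b') * (psi w c' * Psim m z b'))) mulr_sumr.
rewrite [RHS]exchange_big; apply: eq_bigr => c' _ /=.
rewrite /unmeasured /= -mulr_sumr [in LHS]mulrCA -mulrA; congr (_ * _).
rewrite mulr_sumr mulr_suml; apply: eq_bigr => b _.
rewrite mulr_sumr mulr_suml; apply: eq_bigr => b' _.
by rewrite rmorphM /=; ring.
Qed.

(** Fixing the labels leaves an independent choice of w at each position, so the sum of products is
    a product of sums. *)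
Lemma sum_labels (H : {ffun 'I_k -> Y} -> C) (f : 'I_k -> W -> C) :
  \sum_z H (labels z) * \prod_i f i (z i).2 = (\sum_ys H ys) * \prod_i \sum_w f i w.
Proof.
rewrite (partition_big labels predT) //= mulr_suml; apply: eq_bigr => ys _.
have -> : \prod_i \sum_w f i w = \prod_i \sum_(c : Y * W | c.1 == ys i) f i c.2.
  apply: eq_bigr => i _; rewrite [RHS]big_mkcond sum_pair [RHS](bigD1 (ys i)) //=.
  rewrite [X in _ + X]big1 ?addr0; first by apply: eq_bigr => w _; rewrite eqxx.
  by move=> y /negPf E; apply: big1 => w _; rewrite E.
rewrite bigA_distr_big_dep mulr_sumr; apply: eq_big => [z|z /eqP-> //].
apply/eqP/familyP => [<- i|E]; first by rewrite unfold_in /= ffunE.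
by apply/ffunP => i; rewrite ffunE; apply/eqP/E.
Qed.

(** Condition (i) at [m] forces b and b' to agree away from [m], where the resolution of the
    identity then contributes 1. There remain d^(k-1) strings b with the given entry at [m], against
    the prefactor d^-k. *)
Lemma unmeasured_sum m y i j :
  \sum_z unmeasured m z y i j = d%:R^-1 * P y i j.
Proof.
(* W is nonempty: an empty sum could not resolve the identity. *)
case: (pickP W) => [w0 _|W0]; last first.
  have := psi_resolution (Ordinal d_gt0) (Ordinal d_gt0).
  rewrite big_pred0 ?eqxx; last by move=> w; have := W0 w.
  by move/eqP; rewrite eq_sym oner_eq0.
case: i j => a c [a' c'].
have N0 : #|{: Y * W}|%:R != 0 :> C.
  by rewrite pnatr_eq0 -lt0n; apply/card_gt0P; exists (y, w0).
have inner (b b' : Bk) :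
    \sum_z (Psim m z b)^* * G (fupd (labels z) m y) (a, b) (a', b') * Psim m z b' =
    #|{: Y * W}|%:R * (P y (a, b m) (a', b' m) * [forall l, (l != m) ==> (b l == b' l)]%:R).
  (* The value 1 at [m] lets the product run over all positions; it yields the factor #|W|, while
     the overwritten label yields #|Y|. *)
  pose f l w := if l != m then (psi w (b l))^* * psi w (b' l) else 1.
  transitivity (\sum_z G (fupd (labels z) m y) (a, b) (a', b') * \prod_l f l (z l).2).
    apply: eq_bigr => z _; rewrite /f -big_mkcond big_split /= /Psim rmorph_prod /=.
    by ring.
  rewrite (sum_labels (fun ys => G (fupd ys m y) (a, b) (a', b'))).
  rewrite (sum_fupd m y (fun ys => G ys (a, b) (a', b'))) G_marginal /=.
  have [/forallP E|_] := boolP [forall l, (l != m) ==> (b l == b' l)]; last by rewrite !mulr0 mul0r.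
  have one : \prod_(l < k | l != m) \sum_w f l w = 1.
    apply: big1 => l lm; rewrite /f lm psi_resolution.
    by have /implyP/(_ lm)/eqP-> := E l; rewrite eqxx.
  by rewrite (bigD1 m) //= one /f eqxx sumr_const card_prod natrM; ring.
rewrite -mulr_sumr.
have -> : \sum_(z : Omega) \sum_(b : Bk | b m == c) \sum_(b' : Bk | b' m == c')
    (Psim m z b)^* * G (fupd (labels z) m y) (a, b) (a', b') * Psim m z b' =
   \sum_(b : Bk | b m == c) #|{: Y * W}|%:R * P y (a, c) (a', c').
  rewrite exchange_big; apply: eq_bigr => b /eqP bm /=.
  rewrite exchange_big (bigD1 (fupd b m c')) /= ?fupd_same //.
  rewrite inner fupd_same bm.
  rewrite (_ : [forall l, (l != m) ==> (b l == fupd b m c' l)]) ?mulr1; last first.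
    by apply/forallP => l; apply/implyP => lm; rewrite fupd_neq.
  rewrite big1 ?addr0 // => b' /andP[/eqP bm' ne]; rewrite inner.
  rewrite (_ : [forall l, (l != m) ==> (b l == b' l)] = false) ?mulr0 //.
  apply: contraNF ne => /forallP E; apply/eqP/ffunP => l; rewrite ffunE.
  by have [->|lm] := eqVneq l m; [|apply/esym/eqP/(implyP (E l))].
rewrite sum_slice // sumr_const card_ord card_ffun !card_ord -[_ *+ (d ^ k)]mulr_natl natrX.
by rewrite exprVn; field; rewrite N0 d_neq0 ?expf_neq0.
Qed.

(** Condition (ii) at [m] leaves a delta in the entries at [m] times a quantity [g] independent of
    them. Setting the two indices equal and summing identifies the constant. *)
Lemma unmeasured_nosignal m z b b' :
  \sum_y \sum_a unmeasured m z y (a, b) (a, b') =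
  (b == b')%:R * (d%:R^-1 * \sum_c \sum_y \sum_a unmeasured m z y (a, c) (a, c)).
Proof.
pose H (b1 b2 : Bk) := \sum_(ys : {ffun 'I_k -> Y} | [forall l, (l != m) ==> (ys l == labels z l)])
    \sum_(a : 'I_dA) \sum_(c : B) G ys (a, fupd b1 m c) (a, fupd b2 m c).
pose g b1 b2 := (Psim m z b1)^* * H b1 b2 * Psim m z b2.
(* Of the three factors 1/d, one comes from condition (ii) and two from restricting b1 and b2 to
   fixed entries at [m]. *)
pose q := d%:R^-1 ^+ k * #|{: Y * W}|%:R^-1 * (d%:R^-1 ^+ 3 * \sum_b1 \sum_b2 g b1 b2).
suff E c c' : \sum_y \sum_a unmeasured m z y (a, c) (a, c') = (c == c')%:R * q.
  rewrite E; under eq_bigr => c _ do rewrite E eqxx mul1r.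
  by rewrite sumr_const card_ord -[q *+ d]mulr_natl mulKf.
have PsimE b1 c1 : Psim m z (fupd b1 m c1) = Psim m z b1.
  by apply: eq_bigr => i im; rewrite fupd_neq.
have HE1 b1 b2 c1 : H (fupd b1 m c1) b2 = H b1 b2.
  by do 3![apply: eq_bigr => ? _]; rewrite fupd_fupd.
have HE2 b1 b2 c1 : H b1 (fupd b2 m c1) = H b1 b2.
  by do 3![apply: eq_bigr => ? _]; rewrite fupd_fupd.
have upd b1 b2 : \sum_y \sum_a G (fupd (labels z) m y) (a, b1) (a, b2) =
    d%:R^-1 * (b1 m == b2 m)%:R * H b1 b2.
  rewrite -G_nosignal [RHS](reindex_onto (fupd (labels z) m) (fun ys => ys m)) /=.
    apply: eq_bigl => y; rewrite fupd_same eqxx andbT; apply/esym/forallP => l.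
    by apply/implyP => lm; rewrite fupd_neq.
  move=> ys /forallP E; apply/ffunP => l; rewrite ffunE.
  by have [->|lm] := eqVneq l m; [|apply/esym/eqP/(implyP (E l))].
transitivity (d%:R^-1 ^+ k * #|{: Y * W}|%:R^-1 *
  \sum_(b1 : Bk | b1 m == c) \sum_(b2 : Bk | b2 m == c') (c == c')%:R * (d%:R^-1 * g b1 b2)).
  transitivity (d%:R^-1 ^+ k * #|{: Y * W}|%:R^-1 *
    \sum_(b1 : Bk | b1 m == c) \sum_(b2 : Bk | b2 m == c')
    (Psim m z b1)^* * (\sum_y \sum_a G (fupd (labels z) m y) (a, b1) (a, b2)) * Psim m z b2).
    rewrite /unmeasured /=; under eq_bigr => y _ do rewrite -mulr_sumr.
    rewrite -mulr_sumr; congr (_ * _).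
    under [LHS]eq_bigr => y _ do rewrite exchange_big /=.
    rewrite exchange_big; apply: eq_bigr => b1 _ /=.
    under [LHS]eq_bigr => y _ do rewrite exchange_big /=.
    rewrite exchange_big; apply: eq_bigr => b2 _ /=.
    rewrite mulr_sumr mulr_suml; apply: eq_bigr => y _.
    by rewrite mulr_sumr mulr_suml.
  congr (_ * _); apply: eq_bigr => b1 /eqP e1; apply: eq_bigr => b2 /eqP e2.
  by rewrite upd e1 e2 /g; ring.
under eq_bigr => b1 _ do rewrite -!mulr_sumr.
rewrite -!mulr_sumr /q mulrCA; congr (_ * (_ * _)).
rewrite sum_slice => [|b1 c1]; last first.
  by apply: eq_bigr => b2 _; rewrite /g HE1 PsimE.
under eq_bigr => b1 _.
  rewrite sum_slice => [|b2 c1]; last by rewrite /g HE2 PsimE.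
  over.
by rewrite -mulr_sumr card_ord /=; ring.
Qed.

End Measurement.

(** * Moving conditions (i) and (ii) to an arbitrary position *)

Section Symmetry.
Variables (C : numClosedFieldType) (k dA d : nat) (Y : finType).
Variables (P : Y -> op C ('I_dA * 'I_d)%type).
Variable G : {ffun 'I_k -> Y} -> op C (ext_idx dA d k).
Hypothesis G_sym : forall (pi : {perm 'I_k}) (ys : {ffun 'I_k -> Y}),
  op_eq (op_mul (op_mul (Wperm C (dA:=dA) (dB:=d) pi) (G [ffun i => ys (pi i)]))
                (op_adj (Wperm C (dA:=dA) (dB:=d) pi))) (G ys).

Definition permute (T : finType) (pi : {perm 'I_k}) (f : {ffun 'I_k -> T}) :=
  [ffun i => f (pi i)].

Lemma permute_inj (T : finType) pi : injective (@permute T pi).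
Proof.
move=> f g /ffunP E; apply/ffunP => i; have := E ((pi^-1)%g i).
by rewrite !ffunE permKV.
Qed.

(** Each row of W^pi has a single entry 1, so conjugation by it merely relabels basis indices. *)
Lemma ext_permute pi ys a b a' b' :
  G ys (a, b) (a', b') = G (permute pi ys) (a, permute pi b) (a', permute pi b').
Proof.
have WE (i l : ext_idx dA d k) : Wperm C pi i l = (l == (i.1, permute pi i.2))%:R.
  rewrite /Wperm -pair_eqE /= [l.1 == _]eq_sym; congr ((_ && _)%:R).
  apply/eqP/eqP => [->|->]; apply/ffunP => x; rewrite !ffunE ?permK //.
  by rewrite permKV.
rewrite -(G_sym pi ys) /op_mul /op_adj.
under eq_bigr => l _ do rewrite WE conjC_nat mulrC.
rewrite sum_delta; under eq_bigr => l _ do rewrite WE.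
by rewrite sum_delta.
Qed.

(** The transposition of [i1] and [m] carries one condition to the other; [nosignal_at] works the
    same way. *)
Lemma marginal_at (i1 m : 'I_k) :
  (forall (y1 : Y) (ab ab' : ext_idx dA d k),
     \sum_(ys : {ffun 'I_k -> Y} | ys i1 == y1) G ys ab ab'
     = P y1 (ab.1, ab.2 i1) (ab'.1, ab'.2 i1)
       * [forall j, (j != i1) ==> (ab.2 j == ab'.2 j)]%:R) ->
  forall (y1 : Y) (ab ab' : ext_idx dA d k),
     \sum_(ys : {ffun 'I_k -> Y} | ys m == y1) G ys ab ab'
     = P y1 (ab.1, ab.2 m) (ab'.1, ab'.2 m)
       * [forall j, (j != m) ==> (ab.2 j == ab'.2 j)]%:R.
Proof.
move=> H y [a b] [a' b'] /=; pose pi := tperm i1 m.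
transitivity (\sum_(ys : {ffun 'I_k -> Y} | ys i1 == y) G ys (a, permute pi b) (a', permute pi b')).
  rewrite [RHS](reindex_inj (@permute_inj _ pi)); apply: eq_big => [ys|ys _].
    by rewrite ffunE tpermL.
  exact: ext_permute.
rewrite H /= !ffunE tpermL; congr (_ * _%:R); congr nat_of_bool.
apply/forallP/forallP => E j; apply/implyP => jm.
  have := E (pi j); rewrite !ffunE tpermK => /implyP; apply.
  by rewrite -(inj_eq (@perm_inj _ pi)) tpermK tpermL.
have := E (pi j); rewrite !ffunE => /implyP; apply.
by rewrite -(inj_eq (@perm_inj _ pi)) tpermK tpermR.
Qed.

Lemma nosignal_at (ik m : 'I_k) :
  (forall (yf : {ffun 'I_k -> Y}) (b b' : {ffun 'I_k -> 'I_d}),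
     \sum_(ys : {ffun 'I_k -> Y} | [forall j, (j != ik) ==> (ys j == yf j)])
        \sum_(a : 'I_dA) G ys (a, b) (a, b')
     = (d%:R)^-1 * (b ik == b' ik)%:R *
       \sum_(ys : {ffun 'I_k -> Y} | [forall j, (j != ik) ==> (ys j == yf j)])
         \sum_(a : 'I_dA) \sum_(c : 'I_d) G ys (a, fupd b ik c) (a, fupd b' ik c)) ->
  forall (yf : {ffun 'I_k -> Y}) (b b' : {ffun 'I_k -> 'I_d}),
     \sum_(ys : {ffun 'I_k -> Y} | [forall j, (j != m) ==> (ys j == yf j)])
        \sum_(a : 'I_dA) G ys (a, b) (a, b')
     = (d%:R)^-1 * (b m == b' m)%:R *
       \sum_(ys : {ffun 'I_k -> Y} | [forall j, (j != m) ==> (ys j == yf j)])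
         \sum_(a : 'I_dA) \sum_(c : 'I_d) G ys (a, fupd b m c) (a, fupd b' m c).
Proof.
move=> H yf b b'; pose pi := tperm ik m.
have cond (ys : {ffun 'I_k -> Y}) :
    [forall j, (j != ik) ==> (permute pi ys j == permute pi yf j)] =
    [forall j, (j != m) ==> (ys j == yf j)].
  apply/forallP/forallP => E j; apply/implyP => jm.
    have := E (pi j); rewrite !ffunE tpermK => /implyP; apply.
    by rewrite -(inj_eq (@perm_inj _ pi)) tpermK tpermL.
  have := E (pi j); rewrite !ffunE => /implyP; apply.
  by rewrite -(inj_eq (@perm_inj _ pi)) tpermK tpermR.
have updE (f : {ffun 'I_k -> 'I_d}) c :
    fupd (permute pi f) ik c = permute pi (fupd f m c).
  apply/ffunP => j; rewrite !ffunE -(inj_eq (@perm_inj _ pi) j ik).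
  by rewrite tpermL.
transitivity (\sum_(ys : {ffun 'I_k -> Y} | [forall j, (j != ik) ==> (ys j == permute pi yf j)])
    \sum_a G ys (a, permute pi b) (a, permute pi b')).
  rewrite [RHS](reindex_inj (@permute_inj _ pi)); apply: eq_big => [ys|ys _].
    by rewrite cond.
  by apply: eq_bigr => a _; apply: ext_permute.
rewrite H !ffunE tpermL; congr (_ * _).
rewrite (reindex_inj (@permute_inj _ pi)); apply: eq_big => [ys|ys _].
  by rewrite cond.
by do 2![apply: eq_bigr => ? _]; rewrite !updE -ext_permute.
Qed.

End Symmetry.

(** * Assembling the bound *)

Lemma povm_outcome (C : numClosedFieldType) (Y I : finType) (P : Y -> op C I) (i : I) :
  is_povm P -> exists y : Y, true.
Proof.
move=> [_ /(_ i i)]; case: (pickP Y) => [y _ _|Y0]; first by exists y.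
rewrite big_pred0 /op1 ?eqxx => [/eqP|y]; last by have := Y0 y.
by rewrite eq_sym oner_eq0.
Qed.

(** A POVM with a single outcome is the identity, which is a product. The case is separate because
    the final comparison of constants uses #|Y| >= 2. *)
Lemma in_1WL_card1 (C : numClosedFieldType) (dA dB : nat) (Y : finType)
    (P : Y -> op C ('I_dA * 'I_dB)%type) :
  #|Y| = 1%N -> is_povm P -> in_1WL P.
Proof.
move=> /eqP/fintype1P[y0 yE] [_ P1].
exists unit, (fun _ => @op1 C 'I_dA), (fun _ _ => @op1 C 'I_dB); split; last split.
- by split=> [_|a a']; [exact: psd_op1 | rewrite sumr_const card_unit].
- move=> _; split=> [y|b b']; first exact: psd_op1.
  by rewrite sumr_const (eq_card1 (x := y0)) // => y; rewrite (yE y) !inE eqxx.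
move=> y i j; rewrite sumr_const card_unit mulr1n (yE y).
have := P1 i j; rewrite (big_pred1 y0) => [->|y']; last by rewrite (yE y') /= eqxx.
by case: i j => a b [a' b']; rewrite /op_tens /op1 xpair_eqE -mulnb natrM.
Qed.

(** The position [m] has expected increment at most dA / k, the total weight being dA; this is
    inserted into [hs2_rounded]. *)
Lemma exists_1WL_hs2_le (C : numClosedFieldType) (dA dB : nat) (Y : finType)
    (k : nat) (P : Y -> op C ('I_dA * 'I_dB)%type) :
  (0 < dA)%N -> (0 < dB)%N -> (0 < k)%N -> is_povm P -> k_extendible k P ->
  exists L : Y -> op C ('I_dA * 'I_dB)%type,
    [/\ is_povm L, in_1WL L & forall y,
      hs2 (fun i j => P y i j - L y i j) <= 16 * dB%:R ^+ 4 * dA%:R ^+ 2 / k%:R].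
Proof.
move=> hA hB hk P_povm [G [[G_psd _] [Gi [Gii Giii]]]].
have [W [psi [psi_res psi_frame]]] := frame_exists C hB.
have [y0 _] := povm_outcome (Ordinal hA, Ordinal hB) P_povm.
have hk1 : (k.-1 < k)%N by rewrite ltn_predL.
have marg m := marginal_at Giii m (Gi (Ordinal hk) erefl).
have nosig m := nosignal_at Giii m (Gii (Ordinal hk1) erefl).
have K_psd := measured_psd psi G_psd.
have [m small] := exists_small_increment K_psd hk.
have tau_psd := unmeasured_psd psi G_psd m.
have tau_meas := unmeasured_measured psi G m.
have tau_sum := unmeasured_sum hB psi_res marg m.
have tau_nosig := unmeasured_nosignal hB psi nosig m.
have povm := rounded_povm hB psi_res P_povm y0 K_psd tau_psd tau_meas tau_sum tau_nosig.
have wl := rounded_1WL hB psi_res P_povm y0 K_psd tau_psd tau_meas tau_sum tau_nosig.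
have le := hs2_rounded hB psi_res psi_frame P_povm y0 K_psd tau_psd tau_meas tau_sum.
have sumK := sum_tr_outcomes hB psi_res P_povm tau_meas tau_sum.
eexists; split; [exact: povm | exact: wl |] => y; apply: le_trans (le y) _.
rewrite sumK in small; apply: le_trans (ler_wpM2l _ small) _.
  by rewrite !mulr_ge0 ?exprn_ge0 ?ler0n.
by rewrite le_eqVlt; apply/orP; left; apply/eqP; ring.
Qed.

(** This is ln(1 + x) <= x at x = -1/2; it makes the factor 2 ln 2 of the bound at least 1. *)
Lemma ln2_ge_half (R : realType) : 1 / 2 <= ln 2 :> R.
Proof.
have := @le_ln1Dx R (- (1 / 2)); have -> : 1 - 1 / 2 = 2^-1 :> R by field.
by rewrite lnV ?posrE ?ltr0n // => /(_ ltac:(lra)); rewrite lerN2.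
Qed.

Unset Implicit Arguments.

Theorem theorem2 (R : realType) (dA dB : nat) (Y : finType) (k : nat)
  (hA : (0 < dA)%N) (hB : (0 < dB)%N) (hk : (2 <= k)%N)
  (P : Y -> op R[i] ('I_dA * 'I_dB)%type) :
  is_povm P -> k_extendible k P ->
  exists L : Y -> op R[i] ('I_dA * 'I_dB)%type,
    is_povm L /\ in_1WL L /\
    forall y : Y,
      trnorm (fun ij ij' => P y ij ij' - L y ij ij')
      <= ((dB%:R ^+ 3 * (#|Y|%:R) ^+ 2 * (dB%:R * #|Y|%:R + 1)
           * Num.sqrt (2 * ln 2 * dA%:R ^+ 3 / k%:R) : R)%:C)%C.
Proof.
move=> P_povm P_ext; set bnd := (_ * Num.sqrt _ : R).
have bnd_ge0 : 0 <= bnd.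
  by rewrite !mulr_ge0 ?exprn_ge0 ?addr_ge0 ?mulr_ge0 ?ler0n ?sqrtr_ge0.
have k0 : (0 < k)%N by apply: leq_trans hk.
(* With at most one outcome, P is its own approximation and the error is 0. *)
have [Y1|Y2] := leqP #|Y| 1.
  exists P; split=> //.
  have [y0 _] := povm_outcome (Ordinal hA, Ordinal hB) P_povm.
  split; first by apply: in_1WL_card1 => //; apply/anti_leq; rewrite Y1; apply/card_gt0P; exists y0.
  move=> y; apply: le_trans (trnorm_le _) _; rewrite /hs2 big1 ?mulr0 ?sqrtC0 ?lecR //.
  by move=> i _; apply: big1 => j _; rewrite subrr normr0 expr0n.
have [L [L_povm L_1WL L_le]] := exists_1WL_hs2_le hA hB k0 P_povm P_ext.
exists L; do 2!split=> //; move=> y; apply: le_trans (trnorm_le _) _.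
have bC : 0 <= bnd%:C%C by rewrite lecR.
rewrite -[leRHS](sqrCK bC) ler_sqrtC ?nnegrE ?exprn_ge0 ?mulr_ge0 ?ler0n ?hs2_ge0 //.
apply: le_trans (ler_wpM2l (ler0n _ _) (L_le y)) _; rewrite card_prod !card_ord.
have -> : (dA * dB)%:R * (16 * dB%:R ^+ 4 * dA%:R ^+ 2 / k%:R) =
    ((16 * dB%:R ^+ 5 * dA%:R ^+ 3 / k%:R : R)%:C)%C.
  rewrite (rmorphM (real_complex R)) fmorphV 2!(rmorphM (real_complex R)).
  rewrite 2!(rmorphXn (real_complex R)) !rmorph_nat natrM; ring.
rewrite -(rmorphXn (real_complex R)) lecR /bnd 3!exprMn sqr_sqrtr; last first.
  have := ln2_ge_half R => l2.
  by rewrite divr_ge0 ?mulr_ge0 ?exprn_ge0 ?ler0n //; lra.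
have -> : 2 * ln 2 * dA%:R ^+ 3 / k%:R = (2 * ln 2) * (dA%:R ^+ 3 / k%:R) :> R by ring.
rewrite -[leLHS]mulrA [leRHS]mulrA; apply: ler_wpM2r.
  by rewrite divr_ge0 ?exprn_ge0 ?ler0n.
have D1 : 1 <= dB%:R :> R by rewrite ler1n.
have N2 : 2 <= #|Y|%:R :> R by rewrite ler_nat.
move: D1 N2 (ln2_ge_half R); move: dB%:R #|Y|%:R (ln 2) => D N l D1 N2 l2.
(* After squaring and cancelling dA^3 / k, the claim 16 D^5 <= D^6 N^4 (D N + 1)^2 (2 ln 2) is
   compared factor by factor; N >= 2 absorbs the 16. *)
have e1 : D ^+ 5 <= (D ^+ 3) ^+ 2 by rewrite -exprM ler_weXn2l.
have e2 : 16 <= (N ^+ 2) ^+ 2.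
  have n4 : 4 <= N ^+ 2 by nra.
  by nra.
have e3 : 1 <= (D * N + 1) ^+ 2 by apply: exprn_ege1; nra.
have e4 : 1 <= 2 * l by lra.
have D5 : 0 <= D ^+ 5 by apply: exprn_ge0; lra.
have -> : 16 * D ^+ 5 = D ^+ 5 * 16 * 1 * 1 by ring.
have D16 : 0 <= D ^+ 5 * 16 by rewrite mulr_ge0 // ler0n.
by apply: ler_pM; [rewrite mulr1 | | apply: ler_pM => //; apply: ler_pM |].
Qed.
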